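(* Let $\mathcal{O}$ be a one-dimensional noetherian domain whose normalization $\tilde{\mathcal{O}}$ is finitely generated over $\mathcal{O}$, and let $\overline{f_*}\colon\mathrm{Chow}(\tilde{\mathcal{O}})\to\mathrm{Chow}(\mathcal{O})$ be the push-forward homomorphism. The canonical homomorphism $$\overline{\mathrm{div}}_{\mathcal{O}}\colon\mathrm{Pic}(\mathcal{O})\to\mathrm{Chow}(\mathcal{O})$$ is surjective if and only if all local Chow groups $\mathrm{Chow}(\mathcal{O}_\mathfrak{p})$, $\mathfrak{p}\in\mathbb{P}(\mathcal{O})$, are trivial. It is injective if and only if the canonical homomorphism $\mathrm{Pic}(\mathcal{O})\to\mathrm{Pic}(\tilde{\mathcal{O}})$, $[\mathfrak{a}]\mapsto[\mathfrak{a}\tilde{\mathcal{O}}]$, is an isomorphism and $\ker(\overline{f_*})$ is trivial.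
   Context: Let $A$ be a one-dimensional noetherian domain with field of fractions $K$ whose normalization (integral closure in $K$) is finitely generated over $A$. $\mathbb{P}(A)$ is the set of maximal ideals of $A$. For $\mathfrak{p}\in\mathbb{P}(A)$, $A_\mathfrak{p}$ is the localization and $\mathrm{ord}_\mathfrak{p}\colon K^*\to\mathbb{Z}$ is the well-defined homomorphism $\frac{a}{b}\mapsto \mathrm{len}_{A_\mathfrak{p}}(A_\mathfrak{p}/aA_\mathfrak{p})-\mathrm{len}_{A_\mathfrak{p}}(A_\mathfrak{p}/bA_\mathfrak{p})$ (nonzero $a,b\in A$), where $\mathrm{len}$ is composition length. $\mathrm{Div}(A)$ is the free abelian group on $\mathbb{P}(A)$; $\mathcal{P}(A)$ is the image of $\mathrm{div}_A\colon K^*\to\mathrm{Div}(A)$, $a\mapsto\sum_{\mathfrak{p}}\mathrm{ord}_\mathfrak{p}(a)\mathfrak{p}$; $\mathrm{Chow}(A)=\mathrm{Div}(A)/\mathcal{P}(A)$. $\mathcal{I}(A)$ is the group of invertible fractional ideals of $A$ and $\mathrm{Pic}(A)=\mathcal{I}(A)/\{aA\mid a\in K^*\}$. For $\mathfrak{a}\in\mathcal{I}(A)$ and $\mathfrak{p}\in\mathbb{P}(A)$ there is $a_\mathfrak{p}\in K^*$ with $\mathfrak{a}_\mathfrak{p}=a_\mathfrak{p}A_\mathfrak{p}$; put $\mathrm{div}_A(\mathfrak{a})=\sum_\mathfrak{p}\mathrm{ord}_\mathfrak{p}(a_\mathfrak{p})\mathfrak{p}$. This homomorphism $\mathcal{I}(A)\to\mathrm{Div}(A)$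 maps principal ideals to principal divisors and so induces $\overline{\mathrm{div}}_A\colon\mathrm{Pic}(A)\to\mathrm{Chow}(A)$. For $\mathfrak{P}\in\mathbb{P}(\tilde{\mathcal{O}})$ and $\mathfrak{p}=\mathfrak{P}\cap\mathcal{O}\in\mathbb{P}(\mathcal{O})$, let $\deg_\mathfrak{p}(\mathfrak{P})$ be the (finite) degree of the field $\tilde{\mathcal{O}}/\mathfrak{P}$ over $\mathcal{O}/\mathfrak{p}$. The push-forward $f_*\colon\mathrm{Div}(\tilde{\mathcal{O}})\to\mathrm{Div}(\mathcal{O})$ sends $\sum_\mathfrak{P}a_\mathfrak{P}\mathfrak{P}$ to $\sum_\mathfrak{P}a_\mathfrak{P}\deg_{\mathfrak{P}\cap\mathcal{O}}(\mathfrak{P})\,(\mathfrak{P}\cap\mathcal{O})$; it satisfies $f_*(\mathrm{div}_{\tilde{\mathcal{O}}}(a))=\mathrm{div}_{\mathcal{O}}(a)$ for $a\in K^*$, hence induces $\overline{f_*}\colon\mathrm{Chow}(\tilde{\mathcal{O}})\to\mathrm{Chow}(\mathcal{O})$. *)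

(* Defs.v *)
From HB Require Import structures.
From mathcomp Require Import all_boot all_order all_algebra.
From mathcomp Require Import boolp classical_sets functions fsbigop.
From mathcomp Require Import freeg.

Set Implicit Arguments.
Unset Strict Implicit.
Unset Printing Implicit Defensive.

Import Order.TTheory GRing.Theory Num.Theory.
Local Open Scope classical_set_scope.
Local Open Scope ring_scope.

(* A domain with field of fractions K is represented by a subring A : set K
   such that every element of K is a quotient of elements of A.  Ideals,
   fractional ideals, localizations and the normalization of A are then sets
   of elements of K as well.  The definitions below make sense for any set
   A : set K; they have their usual meaning when A is a subring of K. *)

(* The elements of the quotient group G / N, for a subgroup N of an abelian
   group G with operation op, are the cosets x N, which are sets of type set T. *)
Definition coset_by (T : Type) (op : T -> T -> T) (N : set T) (x : T) : set T :=
  op x @` N.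

Definition quotient_group (T : Type) (op : T -> T -> T) (G N : set T) :
    set (set T) :=
  coset_by op N @` G.

(* The map x N |-> f(x) N' induced by f, computed on a representative picked in
   the coset (x0 is only used on the empty set, which is not a coset). *)
Definition induced_map (T T' : choiceType) (x0 : T) (f : T -> T')
    (op' : T' -> T' -> T') (N' : set T') (C : set T) : set T' :=
  coset_by op' N' (f (xget x0 C)).

Section Orders.
Context {K : fieldType}.
Implicit Types (A B M N I p P : set K).

Definition is_subring A := subring_closed [in A].

Definition has_fraction_field A :=
  forall x, exists a b, [/\ A a, A b, b != 0 & x = a / b].

Definition is_submodule A M :=
  [/\ M 0, forall x y, M x -> M y -> M (x + y)
     & forall a x, A a -> M x -> M (a * x)].

Definition module_span A n (s : 'I_n -> K) : set K :=
  [set x | exists2 c : 'I_n -> K, (forall i, A (c i)) & x = \sum_i c i * s i].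

Definition finitely_generated A M := exists n (s : 'I_n -> K), M = module_span A s.

Definition is_ideal A I := is_submodule A I /\ I `<=` A.

Definition is_noetherian A := forall I, is_ideal A I -> finitely_generated A I.

Definition is_prime A p :=
  [/\ is_ideal A p, p != A &
      forall a b, A a -> A b -> p (a * b) -> p a \/ p b].

Definition maximal_ideals A : set (set K) :=
  [set p | [/\ is_ideal A p, p != A &
      forall I, is_ideal A I -> p `<=` I -> I = p \/ I = A]].

Definition prime_chain A n (c : nat -> set K) :=
  (forall i, (i <= n)%N -> is_prime A (c i)) /\
  (forall i, (i < n)%N -> c i `<` c i.+1).

Definition has_krull_dim A n :=
  (exists c, prime_chain A n c) /\ ~ (exists c, prime_chain A n.+1 c).

Definition normalization A : set K :=
  [set x | exists q : {poly K},
      [/\ q \is monic, q \is a polyOver [in A] & root q x]].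

(* M_p = {x / s | x in M, s in A \ p}; the local ring A_p is localize A p A. *)
Definition localize A p M : set K :=
  [set x / s | x in M & s in A `\` p].

Definition principal A (x : K) : set K := [set x * a | a in A].

(* S is a composition series of length n of the A-module M / N, each term of
   which is given by its inverse image in M. *)
Definition composition_series A M N n (S : nat -> set K) :=
  [/\ S 0%N = N, S n = M,
      (forall i, (i <= n)%N -> is_submodule A (S i)) &
      forall i, (i < n)%N -> S i `<` S i.+1 /\
        forall L, is_submodule A L -> S i `<=` L -> L `<=` S i.+1 ->
          L = S i \/ L = S i.+1].

(* The composition length of M / N; the junk value 0 is taken if there is no
   composition series. *)
Definition len A M N : nat :=
  xget 0%N [set n | exists S, composition_series A M N n S].

(* ord_p(a / b) = len(A_p / a A_p) - len(A_p / b A_p), with an arbitrary choice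
   of a and b. *)
Definition ord A p (x : K) : int :=
  let Ap := localize A p A in
  let ab := xget (0, 1) [set ab : K * K |
    [/\ A ab.1, A ab.2, ab.2 != 0 & x = ab.1 / ab.2]] in
  (len Ap Ap (principal Ap ab.1))%:Z - (len Ap Ap (principal Ap ab.2))%:Z.

(* The free abelian group on the maximal ideals of A, as the subgroup of the
   free abelian group on all subsets of K formed by the elements supported on
   maximal ideals. *)
Definition Div A : set {freeg (set K) / int} :=
  [set D | forall p, coeff p D != 0 -> maximal_ideals A p].

Definition div_elt A (x : K) : {freeg (set K) / int} :=
  \sum_(p \in maximal_ideals A) << ord A p x *g p >>.

Definition principal_divisors A : set {freeg (set K) / int} :=
  [set div_elt A x | x in [set x | x != 0]].

Definition Chow A := quotient_group +%R (Div A) (principal_divisors A).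

Definition Chow0 A : set {freeg (set K) / int} :=
  coset_by +%R (principal_divisors A) 0.

Definition mulm M N : set K :=
  [set x | exists2 s : seq (K * K), (forall u, u \in s -> M u.1 /\ N u.2)
           & x = \sum_(u <- s) u.1 * u.2].

Definition is_fractional_ideal A M :=
  [/\ is_submodule A M, exists2 x, M x & x != 0
    & exists d, [/\ A d, d != 0 & forall x, M x -> A (d * x)]].

Definition invertible_ideals A : set (set K) :=
  [set M | is_fractional_ideal A M /\
           exists2 N, is_fractional_ideal A N & mulm M N = A].

Definition principal_ideals A : set (set K) :=
  [set principal A x | x in [set x | x != 0]].

Definition Pic A :=
  quotient_group mulm (invertible_ideals A) (principal_ideals A).

Definition local_generator A p M : K :=
  xget 0 [set x | x != 0 /\ localize A p M = principal (localize A p A) x].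

Definition div_ideal A M : {freeg (set K) / int} :=
  \sum_(p \in maximal_ideals A) << ord A p (local_generator A p M) *g p >>.

Definition div_bar A : set (set K) -> set {freeg (set K) / int} :=
  induced_map set0 (div_ideal A) +%R (principal_divisors A).

Definition Pic_extend B : set (set K) -> set (set K) :=
  induced_map set0 (mulm^~ B) mulm (principal_ideals B).

(* s is a family in B whose residue classes form a basis of the vector space
   B / P over the field A / (P :&: A). *)
Definition residue_basis A B P n (s : 'I_n -> K) :=
  [/\ forall i, B (s i),
      forall b, B b -> exists2 c : 'I_n -> K,
        (forall i, A (c i)) & P (b - \sum_i c i * s i)
    & forall c : 'I_n -> K, (forall i, A (c i)) -> P (\sum_i c i * s i) ->
        forall i, (P `&` A) (c i)].

Definition residue_degree A B P : nat :=
  xget 0%N [set n | exists s : 'I_n -> K, residue_basis A B P s].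

Definition push_forward A B (D : {freeg (set K) / int}) :
    {freeg (set K) / int} :=
  \sum_(P <- dom D) << coeff P D * (residue_degree A B P)%:Z *g P `&` A >>.

Definition push_forward_bar A B :
    set {freeg (set K) / int} -> set {freeg (set K) / int} :=
  induced_map 0 (push_forward A B) +%R (principal_divisors A).

Definition ker_push_forward_bar A B : set (set {freeg (set K) / int}) :=
  [set C | Chow B C /\ push_forward_bar A B C = Chow0 A].

End Orders.

(* Main.v *)
From HB Require Import structures.
Require Import Defs.
From mathcomp Require Import all_boot all_order all_algebra.
From mathcomp Require Import boolp classical_sets functions fsbigop.
From mathcomp Require Import freeg.
From mathcomp Require Import ring.

Set Implicit Arguments.
Unset Strict Implicit.
Unset Printing Implicit Defensive.

Import GRing.Theory.
Local Open Scope classical_set_scope.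
Local Open Scope ring_scope.

(** Every quotient involved has finite length over O: a maximal counterexample
    argument shows it for O / I with I nonzero ([noetherian_dim1_finlen]), and
    it follows for the normalization B, which has a common denominator over O,
    and for the local rings of O.  For a ring with this property, counting the
    annihilators of the simple factors in a composition series gives an
    element of the free group on the maximal ideals; the difference [chi] of
    two such counts is the divisor of a fractional ideal.  Localizing a series at
    p only keeps the factors A / p ([comp_loc]), so the coefficients of [chi] are
    differences of local lengths, and [chi] computes both div of an element and
    div of an invertible ideal ([div_eltE], [div_idealE]).  Multiplication by an
    invertible ideal is an automorphism of the lattice of submodules, so [chi] is
    multiplicative ([chi_mul]) without any reference to local generators.

    Surjectivity.  A local generator of an invertible ideal with divisor p has
    order 1 at p.  Conversely, if a / b has order 1 at p, the p-primary parts of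
    aO and bO are invertible ([chi_primary]) and their quotient has divisor p.
    Having elements of order 1 means that the local Chow group is trivial
    ([local_Chow]).

    Injectivity.  A simple quotient B / P has over O the length given by the
    residue degree, all factors being O modulo the contraction of P.  Hence
    push-forward turns lengths over B into lengths over O, and
    chi M = f_* (chi (M B)) for M invertible over O ([push_chi]).  In other words
    Pic O -> Chow O is the composite Pic O -> Pic B -> Chow B -> Chow O.  The
    middle map is an isomorphism: maximal ideals of B are invertible
    ([normalization_primes_inv]), so that composition series over B are
    factorizations into primes ([comp_prodm_eq]).  The first map is surjective:
    an invertible ideal J of B is generated by one element y modulo f J, where f
    is the conductor, and then yO + f J is an invertible ideal of O with extension
    J ([inverse_descend]).  Hence the composite is injective if and only if the
    first map is bijective and the last one injective. *)

(** * Submodules of a field *)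

Section Submodules.
Context {K : fieldType}.
Implicit Types (A B L M N X I p q : set K) (x y : K).

Lemma ring1 A : is_subring A -> A 1.
Proof. by case=> h _ _; move: h; rewrite !inE. Qed.

Lemma ringB A x y : is_subring A -> A x -> A y -> A (x - y).
Proof.
by move=> [_ h _] Ax Ay; have := h _ _ (mem_set Ax) (mem_set Ay); rewrite !inE.
Qed.

Lemma ringM A x y : is_subring A -> A x -> A y -> A (x * y).
Proof.
by move=> [_ _ h] Ax Ay; have := h _ _ (mem_set Ax) (mem_set Ay); rewrite !inE.
Qed.

Lemma ring0 A : is_subring A -> A 0.
Proof. by move=> Ar; have := ringB Ar (ring1 Ar) (ring1 Ar); rewrite subrr. Qed.

Lemma ringN A x : is_subring A -> A x -> A (- x).
Proof. by move=> Ar Ax; have := ringB Ar (ring0 Ar) Ax; rewrite sub0r. Qed.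

Lemma ringD A x y : is_subring A -> A x -> A y -> A (x + y).
Proof.
by move=> Ar Ax Ay; have := ringB Ar Ax (ringN Ar Ay); rewrite opprK.
Qed.

Lemma submod0 A M : is_submodule A M -> M 0.
Proof. by case. Qed.

Lemma submodD A M x y : is_submodule A M -> M x -> M y -> M (x + y).
Proof. by case=> _ + _; apply. Qed.

Lemma submodM A M a x : is_submodule A M -> A a -> M x -> M (a * x).
Proof. by case=> _ _; apply. Qed.

Lemma submodN A M x : is_subring A -> is_submodule A M -> M x -> M (- x).
Proof.
by move=> Ar MM Mx; rewrite -mulN1r; apply: (submodM MM) (ringN Ar (ring1 Ar)) Mx.
Qed.

Lemma submodB A M x y :
  is_subring A -> is_submodule A M -> M x -> M y -> M (x - y).
Proof. by move=> Ar MM Mx My; apply: (submodD MM) Mx (submodN Ar MM My). Qed.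

Lemma submod_sum A M (I : Type) (r : seq I) (P : pred I) (F : I -> K) :
  is_submodule A M -> (forall i, P i -> M (F i)) -> M (\sum_(i <- r | P i) F i).
Proof.
move=> MM MF; elim/big_ind: _ => //; first exact: submod0 MM.
by move=> x y; apply: submodD MM.
Qed.

Lemma submod_ring A : is_subring A -> is_submodule A A.
Proof.
move=> Ar; split; first exact: ring0.
  by move=> x y; apply: ringD.
by move=> x y; apply: ringM.
Qed.

Lemma submodI A M N :
  is_submodule A M -> is_submodule A N -> is_submodule A (M `&` N).
Proof.
move=> [M0 MD MZ] [N0 ND NZ]; split=> [//|x y [? ?] [? ?]|a x ? [? ?]].
  by split; [apply: MD|apply: ND].
by split; [apply: MZ|apply: NZ].
Qed.

Lemma submod_restrict A B M : A `<=` B -> is_submodule B M -> is_submodule A M.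
Proof. by move=> AB [M0 MD MZ]; split=> // a x /AB; apply: MZ. Qed.

(** [principal M x] is xM for any submodule M, so the definition made for principal
    ideals also provides scaling. *)
Lemma submod_scale A M x : is_submodule A M -> is_submodule A (principal M x).
Proof.
move=> [M0 MD MZ]; split; first by exists 0; rewrite ?mulr0.
  by move=> _ _ [u Mu <-] [v Mv <-]; exists (u + v); rewrite ?mulrDr //; apply: MD.
by move=> a _ Aa [u Mu <-]; exists (a * u); [apply: MZ|rewrite mulrCA].
Qed.

Lemma scale_mul M x y : principal (principal M x) y = principal M (y * x).
Proof.
apply/seteqP; split=> [_ [_ [u Mu <-] <-]|_ [u Mu <-]].
  by exists u; rewrite ?mulrA.
by exists (x * u); rewrite ?mulrA //; exists u.
Qed.

Lemma scale1 M : principal M 1 = M.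
Proof.
apply/seteqP; split=> [_ [u Mu <-]|u Mu]; first by rewrite mul1r.
by exists u; rewrite ?mul1r.
Qed.

Lemma scaleK M x : x != 0 -> principal (principal M x) x^-1 = M.
Proof. by move=> x0; rewrite scale_mul mulVf // scale1. Qed.

Lemma scaleVK M x : x != 0 -> principal (principal M x^-1) x = M.
Proof. by move=> x0; rewrite scale_mul divff // scale1. Qed.

Lemma scaleS M N x : M `<=` N -> principal M x `<=` principal N x.
Proof. by move=> MN _ [u /MN Nu <-]; exists u. Qed.

Lemma scale_sub A M x : is_submodule A M -> M x -> principal A x `<=` M.
Proof. by move=> MM Mx _ [a Aa <-]; rewrite mulrC; apply: (submodM MM). Qed.

Lemma mem_scale A x : is_subring A -> principal A x x.
Proof. by move=> Ar; exists 1; rewrite ?mulr1 //; apply: ring1. Qed.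

Definition addm M N : set K := [set x + y | x in M & y in N].

Lemma submod_add A M N :
  is_submodule A M -> is_submodule A N -> is_submodule A (addm M N).
Proof.
move=> [M0 MD MZ] [N0 ND NZ]; split; first by exists 0 => //; exists 0; rewrite ?addr0.
  move=> _ _ [x Mx [y Ny <-]] [u Mu [v Nv <-]].
  exists (x + u); first exact: MD.
  by exists (y + v); [exact: ND|rewrite addrACA].
move=> a _ Aa [x Mx [y Ny <-]]; exists (a * x); first exact: MZ.
by exists (a * y); [exact: NZ|rewrite mulrDr].
Qed.

Lemma addm_subl A M N : is_submodule A N -> M `<=` addm M N.
Proof. by move=> NN x Mx; exists x => //; exists 0; rewrite ?addr0 //; apply: submod0 NN. Qed.

Lemma addm_subr A M N : is_submodule A M -> N `<=` addm M N.
Proof. by move=> MM x Mx; exists 0; [apply: submod0 MM|exists x; rewrite ?add0r]. Qed.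

Lemma addm_min A M N X :
  is_submodule A X -> M `<=` X -> N `<=` X -> addm M N `<=` X.
Proof.
by move=> XX MX NX _ [x /MX Xx [y /NX Xy <-]]; apply: (submodD XX).
Qed.

Lemma addmS M N X : M `<=` N -> addm M X `<=` addm N X.
Proof. by move=> MN _ [x /MN Nx [y Xy <-]]; exists x => //; exists y. Qed.

Lemma addm_absorb A M N :
  is_submodule A M -> is_submodule A N -> N `<=` M -> addm M N = M.
Proof.
move=> MM NN NM; apply/seteqP; split; last exact: (addm_subl NN).
exact: (addm_min MM).
Qed.

Lemma addmC M N : addm M N = addm N M.
Proof.
by apply/seteqP; split=> z [x Mx [y Ny <-]]; exists y => //; exists x; rewrite // addrC.
Qed.

Lemma modular A L M X : is_subring A -> is_submodule A L -> is_submodule A M ->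
  L `<=` M -> M `&` addm L X `<=` addm L (M `&` X).
Proof.
move=> Ar LL MM LM z [Mz [x Lx [y Xy zE]]]; exists x => //; exists y => //.
by split=> //; have := submodB Ar MM Mz (LM _ Lx); rewrite -zE addrC addKr.
Qed.

End Submodules.

(** * Composition series and their annihilators *)

Section Composition.
Context {K : fieldType}.
Implicit Types (A B L M N X I p q : set K) (x y : K).

Definition simple A L M :=
  [/\ is_submodule A L, is_submodule A M, L `<` M &
    forall X, is_submodule A X -> L `<=` X -> X `<=` M -> X = L \/ X = M].

Definition colon A L M : set K := [set a | A a /\ forall x, M x -> L (a * x)].

(** The annihilators of the simple quotients are kept, from the top down, and not
    just their number, because one series over a domain then gives the lengths
    over all its local rings at once. *)
Inductive cseries A N : set K -> seq (set K) -> Prop :=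
| comp_nil : is_submodule A N -> cseries A N N [::]
| comp_cons L M q s :
    cseries A N L s -> simple A L M -> q = colon A L M -> cseries A N M (q :: s).

Lemma maximal_sub A p : maximal_ideals A p -> p `<=` A.
Proof. by case=> -[]. Qed.

Lemma maximal_submod A p : maximal_ideals A p -> is_submodule A p.
Proof. by case=> -[]. Qed.

Lemma maximal_not1 A p : is_subring A -> maximal_ideals A p -> ~ p 1.
Proof.
move=> Ar [[pm pA] /eqP pNA _] p1; apply: pNA; apply/seteqP; split=> // a Aa.
by rewrite -(mulr1 a); apply: (submodM pm).
Qed.

Lemma maximal_eq A p q :
  is_subring A -> maximal_ideals A p -> maximal_ideals A q -> p `<=` q -> p = q.
Proof.
move=> Ar [_ _ pmax] qm pq; have [qi /eqP qA _] := qm.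
by case: (pmax _ qi pq) => // /qA.
Qed.

Lemma maximal_comax A p a : is_subring A -> maximal_ideals A p -> A a -> ~ p a ->
  exists b c, [/\ A b, p c & b * a + c = 1].
Proof.
move=> Ar pm Aa npa; have [[ps pA] _ pmax] := pm.
have Am := submod_ring Ar.
have Is : is_submodule A (addm p (principal A a)).
  exact: submod_add ps (submod_scale a Am).
have IA : addm p (principal A a) `<=` A.
  by apply: (addm_min Am) => // _ [b Ab <-]; apply: ringM.
have pI : p `<=` addm p (principal A a) by apply: addm_subl; apply: submod_scale Am.
have [eI|eI] := pmax _ (conj Is IA) pI.
  case: npa; rewrite -eI; apply: (addm_subr ps); exact: mem_scale.
have [c pc [_ [b Ab <-] e]] : addm p (principal A a) 1 by rewrite eI; apply: ring1.
by exists b, c; split=> //; rewrite -e mulrC addrC.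
Qed.

Lemma maximal_prime A p : is_subring A -> maximal_ideals A p -> is_prime A p.
Proof.
move=> Ar pm; have [pi pA _] := pm; split=> // a b Aa Ab pab.
case: (pselect (p a)) => [|npa]; [by left|right].
have [u [c [Au pc e]]] := maximal_comax Ar pm Aa npa.
rewrite -(mul1r b) -e mulrDl; have ps := maximal_submod pm.
apply: (submodD ps); first by rewrite -mulrA; apply: (submodM ps).
by rewrite mulrC; apply: (submodM ps).
Qed.

Lemma ideal_proper A I : is_subring A -> is_ideal A I -> I <> A -> ~ I 1.
Proof.
move=> Ar [Is IA] IneqA I1; apply: IneqA; apply/seteqP; split=> // a Aa.
by rewrite -(mulr1 a); apply: (submodM Is).
Qed.

Lemma colon_ideal A L M :
  is_subring A -> is_submodule A L -> is_ideal A (colon A L M).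
Proof.
move=> Ar [L0 LD LZ]; split; last by move=> a [].
split.
- by split=> [|x _]; [apply: ring0|rewrite mul0r].
- move=> a b [Aa La] [Ab Lb]; split=> [|x Mx]; first exact: ringD.
  by rewrite mulrDl; apply: LD; [apply: La|apply: Lb].
- move=> a b Aa [Ab Lb]; split=> [|x Mx]; first exact: ringM.
  by rewrite -mulrA; apply: LZ => //; apply: Lb.
Qed.

Lemma simple_span A L M x : is_subring A -> simple A L M -> M x -> ~ L x ->
  M = addm L (principal A x).
Proof.
move=> Ar [Ls Ms [LM _] mid] Mx nLx; have Am := submod_ring Ar.
have xs := submod_scale x Am.
case: (mid (addm L (principal A x))) => //.
- exact: submod_add.
- exact: addm_subl xs.
- by apply: (addm_min Ms) => //; apply: (scale_sub Ms).
- by move=> e; case: nLx; rewrite -e; apply: (addm_subr Ls); apply: mem_scale.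
Qed.

Lemma simple_elt A L M : simple A L M -> exists2 x, M x & ~ L x.
Proof.
by move=> [_ _ [_ nML] _]; apply: contrapT => h; apply: nML => x Mx;
   apply: contrapT => nLx; apply: h; exists x.
Qed.

Lemma colon_span A L M x a : is_subring A -> simple A L M -> M x -> ~ L x ->
  A a -> L (a * x) -> colon A L M a.
Proof.
move=> Ar LM Mx nLx Aa Lax; split=> // y; rewrite (simple_span Ar LM Mx nLx).
have [Ls _ _ _] := LM; move=> [u Lu [_ [b Ab <-] <-]]; rewrite mulrDr.
apply: (submodD Ls); first exact: (submodM Ls).
by rewrite mulrA mulrC; apply: (submodM Ls).
Qed.

Lemma colon_maximal A L M :
  is_subring A -> simple A L M -> maximal_ideals A (colon A L M).
Proof.
move=> Ar LM; have [Ls Ms _ mid] := LM; have [x Mx nLx] := simple_elt LM.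
split; first exact: colon_ideal.
  apply/eqP => e; have [_ /(_ x Mx)] : colon A L M 1 by rewrite e; apply: ring1.
  by rewrite mul1r.
move=> I [Is IA] qI.
case: (mid (addm L (principal I x))).
- exact: submod_add Ls (submod_scale x Is).
- by apply: addm_subl; apply: submod_scale Is.
- apply: (addm_min Ms); first by case: LM => _ _ [].
  by move=> _ [a /IA Aa <-]; rewrite mulrC; apply: (submodM Ms).
- move=> e; left; apply/seteqP; split=> // a Ia; have Aa := IA _ Ia.
  apply: (colon_span Ar LM Mx nLx Aa); rewrite -e mulrC.
  by apply: (addm_subr Ls); exists a.
- move=> e; right; apply/seteqP; split=> // a Aa.
  have: addm L (principal I x) x by rewrite e.
  move=> [u Lu [_ [i Ii <-] xE]].
  have qi : colon A L M (1 - i).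
    apply: (colon_span Ar LM Mx nLx); first exact: ringB Ar (ring1 Ar) (IA _ Ii).
    by rewrite mulrBl mul1r -{1}xE (mulrC i) addrK.
  rewrite -(mulr1 a); apply: (submodM Is) => //.
  by rewrite -(subrK i 1); apply: (submodD Is) => //; apply: qI.
Qed.

Lemma colon_simple A L M L' M' : is_subring A -> simple A L M -> simple A L' M' ->
  colon A L M `<=` colon A L' M' -> colon A L M = colon A L' M'.
Proof. by move=> Ar s s'; apply: (maximal_eq Ar); apply: colon_maximal. Qed.

(** This is the way simple quotients are produced: adjoining to N an element whose
    annihilator modulo N is a maximal ideal. *)
Lemma simple_addx A q N x : is_subring A -> maximal_ideals A q ->
  is_submodule A N -> ~ N x -> (forall a, q a -> N (a * x)) ->
  simple A N (addm N (principal A x)) /\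
  colon A N (addm N (principal A x)) = q.
Proof.
move=> Ar qm Ns nNx qx; have Am := submod_ring Ar.
have xs := submod_scale x Am.
have Mx : addm N (principal A x) x by apply: (addm_subr Ns); apply: mem_scale.
have sim : simple A N (addm N (principal A x)).
  split=> //; first exact: submod_add.
    by split; [apply: addm_subl xs|move=> /(_ x Mx)].
  move=> X Xs NX XM; case: (pselect (X = N)) => [|XN]; [by left|right].
  apply/seteqP; split=> //; apply: (addm_min Xs) => //.
  have [y Xy nNy] : exists2 y, X y & ~ N y.
    apply: contrapT => h; apply: XN; apply/seteqP; split=> // y Xy.
    by apply: contrapT => nNy; apply: h; exists y.
  have [n Nn [_ [a Aa <-] yE]] := XM _ Xy.
  have nqa : ~ q a.
    move=> /qx Nax; apply: nNy; rewrite -yE (mulrC x); exact: (submodD Ns Nn Nax).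
  have [b [c [Ab qc e]]] := maximal_comax Ar qm Aa nqa.
  apply: (scale_sub Xs); rewrite -(mul1r x) -e mulrDl.
  apply: (submodD Xs); last by apply: NX; apply: qx.
  rewrite -mulrA; apply: (submodM Xs) => //.
  have -> : a * x = y - n by rewrite -yE; ring.
  by apply: (submodB Ar Xs) => //; apply: NX.
split=> //; apply/esym/(maximal_eq Ar qm); first exact: colon_maximal.
move=> a qa; apply: (colon_span Ar sim Mx nNx); first exact: (maximal_sub qm).
exact: qx.
Qed.

Lemma comp_submodl A N M s : cseries A N M s -> is_submodule A N.
Proof. by elim. Qed.

Lemma comp_submodr A N M s : cseries A N M s -> is_submodule A M.
Proof. by case=> // ? ? ? ? _ []. Qed.

Lemma comp_sub A N M s : cseries A N M s -> N `<=` M.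
Proof.
elim=> [_|L {}M _ {}s _ NL [_ _ [LM _] _] _]; first exact: subset_refl.
exact: subset_trans NL LM.
Qed.

Lemma comp_nilP A N M : cseries A N M [::] -> M = N.
Proof. by move=> c; inversion c. Qed.

Lemma comp_consP A N M q s : cseries A N M (q :: s) ->
  exists L, [/\ cseries A N L s, simple A L M & q = colon A L M].
Proof. by move=> c; inversion c; exists L. Qed.

Lemma comp_same A N s : cseries A N N s -> s = [::].
Proof.
case: s => // q s /comp_consP[L [/comp_sub NL [_ _ [_ nNL] _] _]].
by case: nNL.
Qed.

Lemma comp_cat A N L M s t : cseries A N L s -> cseries A L M t -> cseries A N M (t ++ s).
Proof.
move=> NL; elim=> [//|L' M' q r _ ih sim qE]; exact: comp_cons ih sim qE.
Qed.

Lemma comp_maximal A N M s q :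
  is_subring A -> cseries A N M s -> q \in s -> maximal_ideals A q.
Proof.
move=> Ar; elim=> // L {}M r {}s _ ih sim ->; rewrite inE => /predU1P[->|/ih //].
exact: colon_maximal.
Qed.

Lemma comp_simple A L M s :
  simple A L M -> cseries A L M s -> s = [:: colon A L M].
Proof.
move=> [Ls _ [LM nML] mid]; case: s => [/comp_nilP e|q s]; first by case: nML; rewrite e.
move=> /comp_consP[X [LX [Xs _ [XM nMX] _] ->]].
case: (mid _ Xs (comp_sub LX) XM) => eX; last by case: nMX; rewrite eX.
by move: LX; rewrite eX => /comp_same ->.
Qed.

Lemma comp_single A L M : simple A L M -> cseries A L M [:: colon A L M].
Proof.
by move=> sim; have [Ls _ _ _] := sim; apply: comp_cons (comp_nil Ls) sim erefl.
Qed.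

(** By the modular law, every simple step of a series survives in exactly one of
    the two series that X cuts out, below and above it.  Additivity of length,
    uniqueness and the second isomorphism theorem all come from this. *)
Lemma comp_slice A N M s X : is_subring A -> cseries A N M s -> is_submodule A X ->
  exists s1 s2, [/\ cseries A (N `&` X) (M `&` X) s1,
    cseries A (addm N X) (addm M X) s2 & perm_eq s (s1 ++ s2)].
Proof.
move=> Ar + Xs; elim=> [Ns|{s}L {}M q s c [s1 [s2 [c1 c2 pe]]] sim qE].
  exists [::], [::]; split=> //; apply: comp_nil; [exact: submodI|exact: submod_add].
have [Ls Ms [LM nML] mid] := sim.
case: (pselect (M `&` X `<=` L)) => MXL.
  have eI : M `&` X = L `&` X.
    by apply/seteqP; split=> x [h Xx]; split=> //; [apply: MXL|apply: LM].
  have sim' : simple A (addm L X) (addm M X).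
    split; [exact: submod_add|exact: submod_add| |].
      split; first exact: addmS.
      move=> h; apply: nML => x Mx.
      have [l Ll [y [My Xy] <-]]: addm L (M `&` X) x.
        apply: (modular Ar Ls Ms LM); split=> //; apply: h; exact: (addm_subl Xs).
      by apply: (submodD Ls) => //; apply: MXL.
    move=> Y Ys LY YM.
    have XY : X `<=` Y by apply: subset_trans LY; apply: (addm_subr Ls).
    case: (mid (Y `&` M)).
    - exact: submodI.
    - move=> x Lx; split; last exact: LM.
      by apply: LY; apply: (addm_subl Xs).
    - by move=> x [].
    - move=> e; left; apply/seteqP; split=> // y Yy.
      have [m Mm [x Xx yE]] := YM _ Yy; exists m; last by exists x.
      rewrite -e; split=> //; rewrite -(addrK x m) yE.
      by apply: (submodB Ar Ys) => //; apply: XY.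
    - move=> e; right; apply/seteqP; split=> //; apply: (addm_min Ys) => //.
      by rewrite -e => x [].
  exists s1, (q :: s2); split; first by rewrite eI.
    apply: (comp_cons c2 sim'); rewrite qE; apply: (colon_simple Ar) => // a [Aa aM].
    split=> // _ [m Mm [x Xx <-]]; rewrite mulrDr; exists (a * m); first exact: aM.
    by exists (a * x) => //; apply: (submodM Xs).
  by rewrite perm_sym -cat1s perm_catCA perm_cons perm_sym.
have [z [Mz Xz] nLz] : exists2 z, (M `&` X) z & ~ L z.
  by apply: contrapT => h; apply: MXL => z MXz; apply: contrapT => nLz; apply: h; exists z.
have Mspan := simple_span Ar sim Mz nLz.
have MLX : M `<=` addm L X.
  rewrite Mspan => _ [l Ll [_ [a Aa <-] <-]]; exists l => //; exists (z * a) => //.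
  by rewrite mulrC; apply: (submodM Xs).
have eS : addm M X = addm L X.
  apply/seteqP; split; last exact: addmS.
  apply: (addm_min (submod_add Ls Xs)) => //; exact: (addm_subr Ls).
have sim' : simple A (L `&` X) (M `&` X).
  split; [exact: submodI|exact: submodI| |].
    split; first by move=> x [/LM].
    by move=> /(_ z (conj Mz Xz)) [].
  move=> Y Ys LY YM.
  have YX : Y `<=` X by move=> y /YM[].
  have YM' : Y `<=` M by move=> y /YM[].
  case: (mid (addm L Y)).
  - exact: submod_add.
  - exact: addm_subl Ys.
  - exact: (addm_min Ms).
  - move=> e; left; apply/seteqP; split=> // y Yy; split; last exact: YX.
    by rewrite -e; apply: (addm_subr Ls).
  - move=> e; right; apply/seteqP; split=> // x [Mx Xx].
    move: Mx; rewrite -e => -[l Ll [y Yy xE]]; rewrite -xE.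
    apply: (submodD Ys) => //; apply: LY; split=> //.
    by rewrite -(addrK y l) xE; apply: (submodB Ar Xs) => //; apply: YX.
exists (q :: s1), s2; split; last by rewrite cat_cons perm_cons.
  apply: (comp_cons c1 sim'); rewrite qE; apply: (colon_simple Ar) => // a [Aa aM].
  by split=> // x [Mx Xx]; split; [apply: aM|apply: (submodM Xs)].
by rewrite eS.
Qed.

Lemma comp_split A N M s X : is_subring A -> cseries A N M s -> is_submodule A X ->
  N `<=` X -> X `<=` M ->
  exists s1 s2, [/\ cseries A N X s1, cseries A X M s2 & perm_eq s (s1 ++ s2)].
Proof.
move=> Ar c Xs NX XM; have [s1 [s2 [c1 c2 pe]]] := comp_slice Ar c Xs.
have Ns := comp_submodl c; have Ms := comp_submodr c.
exists s1, s2; split=> //.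
  by move: c1; rewrite (setIidl NX) (setIidr XM).
by move: c2; rewrite (addm_absorb Ms Xs XM) addmC (addm_absorb Xs Ns NX).
Qed.

(** Second isomorphism theorem: the part of the series cut out below N is trivial. *)
Lemma comp_quotient A N X s : is_subring A -> is_submodule A N ->
  cseries A (X `&` N) X s -> exists2 t, cseries A N (addm X N) t & perm_eq s t.
Proof.
move=> Ar Ns c; have [s1 [s2 [c1 c2 pe]]] := comp_slice Ar c Ns.
move: c1 c2 pe; rewrite -setIA setIid => /comp_same -> c2 pe; exists s2 => //.
have XNs := comp_submodl c.
by move: c2; rewrite addmC (addm_absorb Ns XNs) // => x [].
Qed.

(** Jordan-Hoelder: the last simple step of one series cuts the other one in two,
    and the upper part has length one. *)
Theorem comp_uniq A N M s t :
  is_subring A -> cseries A N M s -> cseries A N M t -> perm_eq s t.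
Proof.
move=> Ar c; elim: c t => [_ t /comp_same -> //|{s}L {}M q s c ih sim qE t ct].
have [Ls _ [LM _] _] := sim.
have [s1 [s2 [c1 c2 pe]]] := comp_split Ar ct Ls (comp_sub c) LM.
rewrite perm_sym (perm_trans pe) // (comp_simple sim c2) -qE perm_catC perm_cons.
by rewrite perm_sym ih.
Qed.

(** The composition factors are subquotients of M / N, so that what kills M / N
    kills them. *)
Lemma comp_colon A N M s q a :
  is_subring A -> cseries A N M s -> q \in s -> colon A N M a -> q a.
Proof.
move=> Ar c; elim: c a => // L {}M r {}s c ih sim rE a; rewrite inE.
have [_ _ [LM _] _] := sim; move=> /predU1P[-> [Aa aM]|qs [Aa aM]].
  by rewrite rE; split=> // x /aM; apply: (comp_sub c).
by apply: ih => //; split=> // x /LM; apply: aM.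
Qed.

End Composition.
(** * Products of submodules *)

Section Products.
Context {K : fieldType}.
Implicit Types (A B I J L M N X p q : set K) (x y : K).

Lemma mem_mulm M N x y : M x -> N y -> mulm M N (x * y).
Proof.
move=> Mx Ny; exists [:: (x, y)]; last by rewrite big_seq1.
by move=> u; rewrite inE => /eqP ->.
Qed.

Lemma mulm0 M N : mulm M N 0.
Proof. by exists [::] => //; rewrite big_nil. Qed.

Lemma mulmD M N x y : mulm M N x -> mulm M N y -> mulm M N (x + y).
Proof.
move=> [s sMN ->] [t tMN ->]; exists (s ++ t); last by rewrite big_cat.
by move=> u; rewrite mem_cat => /orP[/sMN|/tMN].
Qed.

Lemma mulm_min M N X : X 0 -> (forall x y, X x -> X y -> X (x + y)) ->
  (forall x y, M x -> N y -> X (x * y)) -> mulm M N `<=` X.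
Proof.
move=> X0 XD XM _ [s sMN ->]; elim: s sMN => [|u s ih] sMN; first by rewrite big_nil.
rewrite big_cons; apply: XD.
  by have [] := sMN u (mem_head _ _); apply: XM.
by apply: ih => v vs; apply: sMN; rewrite inE vs orbT.
Qed.

Lemma mulm_subset A M N X : is_submodule A X ->
  (forall x y, M x -> N y -> X (x * y)) -> mulm M N `<=` X.
Proof. by case=> X0 XD _; apply: mulm_min. Qed.

Lemma mulmS M N M' N' : M `<=` M' -> N `<=` N' -> mulm M N `<=` mulm M' N'.
Proof.
move=> MM NN; apply: mulm_min; [exact: mulm0|exact: mulmD|].
by move=> x y /MM Mx /NN Ny; apply: mem_mulm.
Qed.

Lemma mulmC M N : mulm M N = mulm N M.
Proof.
by apply/seteqP; split; apply: mulm_min; do ?[exact: mulm0|exact: mulmD];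
   move=> x y Mx Ny; rewrite mulrC; apply: mem_mulm.
Qed.

Lemma mulmA L M N : mulm L (mulm M N) = mulm (mulm L M) N.
Proof.
apply/seteqP; split; (apply: mulm_min; [exact: mulm0|exact: mulmD|]).
  move=> x y Lx; suff h : mulm M N `<=` [set z | mulm (mulm L M) N (x * z)] by move/h.
  apply: mulm_min => /= [|u v|u v Mu Nv]; first by rewrite mulr0; apply: mulm0.
    by rewrite mulrDr; apply: mulmD.
  by rewrite mulrA; do 2!apply: mem_mulm => //.
move=> y x + Nx; suff h : mulm L M `<=` [set z | mulm L (mulm M N) (z * x)] by move/h.
apply: mulm_min => /= [|u v|u v Mu Nv]; first by rewrite mul0r; apply: mulm0.
  by rewrite mulrDl; apply: mulmD.
by rewrite -mulrA; do 2!apply: mem_mulm => //.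
Qed.

Lemma mulmCA L M N : mulm L (mulm M N) = mulm M (mulm L N).
Proof. by rewrite !mulmA (mulmC L). Qed.

Lemma submod_mulm A M N : is_submodule A M -> is_submodule A (mulm M N).
Proof.
move=> Ms; split; [exact: mulm0|by move=> x y; apply: mulmD|].
move=> a x Aa; suff h : mulm M N `<=` [set z | mulm M N (a * z)] by move/h.
apply: mulm_min => /= [|u v|u v Mu Nv]; first by rewrite mulr0; apply: mulm0.
  by rewrite mulrDr; apply: mulmD.
by rewrite mulrA; apply: mem_mulm => //; apply: (submodM Ms).
Qed.

Lemma submod_mulmr A M N : is_submodule A N -> is_submodule A (mulm M N).
Proof. by rewrite mulmC; apply: submod_mulm. Qed.

Lemma mulm_ring A M : is_subring A -> is_submodule A M -> mulm A M = M.
Proof.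
move=> Ar Ms; apply/seteqP; split.
  by apply: (mulm_subset Ms) => a x; apply: submodM.
by move=> x Mx; rewrite -(mul1r x); apply: mem_mulm => //; apply: ring1.
Qed.

Lemma mulm_ringr A M : is_subring A -> is_submodule A M -> mulm M A = M.
Proof. by rewrite mulmC; apply: mulm_ring. Qed.

Lemma mulm_idl A I M : is_submodule A M -> I `<=` A -> mulm I M `<=` M.
Proof. by move=> Ms IA; apply: (mulm_subset Ms) => a x /IA; apply: submodM. Qed.

Lemma mulm_scalel M N x : mulm (principal M x) N = principal (mulm M N) x.
Proof.
apply/seteqP; split.
  apply: mulm_min; first by exists 0; rewrite ?mulr0 //; apply: mulm0.
    move=> _ _ [u uMN <-] [v vMN <-]; exists (u + v); rewrite ?mulrDr //.
    exact: mulmD.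
  by move=> _ y [u Mu <-] Ny; exists (u * y); rewrite ?mulrA //; apply: mem_mulm.
move=> _ [y My <-]; move: y My.
suff: mulm M N `<=` [set y | mulm (principal M x) N (x * y)] by [].
apply: mulm_min => /= [|u v|u v Mu Nv]; first by rewrite mulr0; apply: mulm0.
  by rewrite mulrDr; apply: mulmD.
by rewrite mulrA; apply: mem_mulm => //; exists u.
Qed.

Lemma mulm_scaler M N x : mulm M (principal N x) = principal (mulm M N) x.
Proof. by rewrite mulmC mulm_scalel mulmC. Qed.

Lemma mulm_principal A M x :
  is_subring A -> is_submodule A M -> mulm (principal A x) M = principal M x.
Proof. by move=> Ar Ms; rewrite mulm_scalel mulm_ring. Qed.

Definition inverse_of A I J :=
  [/\ is_submodule A I, is_submodule A J & mulm I J = A].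

Lemma inverse_sym A I J : inverse_of A I J -> inverse_of A J I.
Proof. by case=> Is Js e; split; rewrite 1?mulmC. Qed.

Lemma inverse_scale A x : is_subring A -> x != 0 ->
  inverse_of A (principal A x) (principal A x^-1).
Proof.
move=> Ar x0; have As := submod_ring Ar; split; try exact: submod_scale.
by rewrite mulm_scalel mulm_ring ?scaleVK //; apply: submod_scale.
Qed.

Lemma inverseK A I J M : is_subring A -> inverse_of A I J -> is_submodule A M ->
  mulm J (mulm I M) = M.
Proof. by move=> Ar [_ _ e] Ms; rewrite mulmA (mulmC J) e mulm_ring. Qed.

Lemma inverse_mul A I J I' J' : is_subring A ->
  inverse_of A I J -> inverse_of A I' J' ->
  inverse_of A (mulm I I') (mulm J J').
Proof.
move=> Ar [Is Js e] [Is' Js' e']; split; try exact: submod_mulm.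
by rewrite -mulmA (mulmCA I') mulmA e e' mulm_ring //; apply: submod_ring.
Qed.

(** Multiplication by an invertible I is an automorphism of the lattice of all
    submodules, so it carries composition series to composition series; this is
    how divisors become multiplicative. *)
Lemma simple_mul A I J L M : is_subring A -> inverse_of A I J ->
  simple A L M ->
  simple A (mulm I L) (mulm I M) /\ colon A (mulm I L) (mulm I M) = colon A L M.
Proof.
move=> Ar h sim; have [Ls Ms [LM nML] mid] := sim.
have [Is Js _] := h; have K1 := inverseK Ar h; have K2 := inverseK Ar (inverse_sym h).
have sim' : simple A (mulm I L) (mulm I M).
  split; [exact: submod_mulm|exact: submod_mulm| |].
    split; first exact: mulmS.
    by move=> /(mulmS (@subset_refl _ J)); rewrite !K1.
  move=> X Xs LX XM.
  case: (mid (mulm J X)); first exact: submod_mulm.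
  - by rewrite -(K1 L) //; apply: mulmS.
  - by rewrite -(K1 M) //; apply: mulmS.
  - by move=> <-; left; rewrite K2.
  - by move=> <-; right; rewrite K2.
split=> //; apply/esym/(colon_simple Ar) => // a [Aa aM]; split=> //.
suff: mulm I M `<=` [set z | mulm I L (a * z)] by [].
apply: mulm_min => /= [|u v|u v Iu Mv]; first by rewrite mulr0; apply: mulm0.
  by rewrite mulrDr; apply: mulmD.
by rewrite mulrCA; apply: mem_mulm => //; apply: aM.
Qed.

Lemma comp_mul A I J M N s : is_subring A -> inverse_of A I J ->
  cseries A N M s -> cseries A (mulm I N) (mulm I M) s.
Proof.
move=> Ar h; have [Is _ _] := h; elim=> [Ns|L {}M q {}s _ ih sim ->].
  by apply: comp_nil; apply: submod_mulm.
have [sim' <-] := simple_mul Ar h sim; exact: comp_cons sim' erefl.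
Qed.

Lemma comp_scale A M N x s : is_subring A -> x != 0 ->
  cseries A N M s -> cseries A (principal N x) (principal M x) s.
Proof.
move=> Ar x0 c; have := comp_mul Ar (inverse_scale Ar x0) c.
by rewrite !mulm_principal //; [exact: comp_submodr c|exact: comp_submodl c].
Qed.

Definition prodm M (s : seq (set K)) : set K := foldr mulm M s.

Lemma prodm_cat M s t : prodm M (s ++ t) = prodm (prodm M t) s.
Proof. by rewrite /prodm foldr_cat. Qed.

Lemma prodm_mulm s N M : prodm (mulm N M) s = mulm N (prodm M s).
Proof. by elim: s => //= q s ->; rewrite mulmCA. Qed.

Lemma prodm_ring A s M : is_subring A -> is_submodule A M ->
  mulm (prodm A s) M = prodm M s.
Proof.
by move=> Ar Ms; rewrite mulmC -prodm_mulm mulm_ringr.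
Qed.

Lemma prodm_perm M s t : perm_eq s t -> prodm M s = prodm M t.
Proof.
elim: s t => [t|q s ih t pe]; first by rewrite perm_sym => /perm_nilP ->.
have /rot_to[i t' e] : q \in t by rewrite -(perm_mem pe) mem_head.
have pe' : perm_eq s t'.
  by rewrite -(perm_cons q) -e perm_sym perm_rot perm_sym.
rewrite /= (ih _ pe') -[RHS](congr1 (prodm M) (cat_take_drop i t)).
have -> : mulm q (prodm M t') = prodm M (drop i t ++ take i t).
  by rewrite -[drop i t ++ _]/(rot i t) e.
elim: (drop i t) => [|r u ihu] /=; first by rewrite cats0.
by rewrite ihu !prodm_cat /= prodm_mulm.
Qed.

Lemma submod_prodm A s M : is_submodule A M -> is_submodule A (prodm M s).
Proof. by move=> Ms; elim: s => //= q s ih; apply: submod_mulmr. Qed.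

Lemma prodm_sub A s M : is_subring A -> is_submodule A M ->
  (forall q, q \in s -> q `<=` A) -> prodm M s `<=` M.
Proof.
move=> Ar Ms; elim: s => [|q s ih] sA /=; first exact: subset_refl.
have sA' r : r \in s -> r `<=` A by move=> rs; apply: sA; rewrite inE rs orbT.
have Ps : is_submodule A (prodm M s) by apply: submod_prodm.
apply: subset_trans (ih sA').
by apply: (mulm_idl Ps); apply: sA; apply: mem_head.
Qed.

Lemma prime_prodm A Q s : is_subring A -> is_prime A Q ->
  (forall q, q \in s -> q `<=` A) -> prodm A s `<=` Q ->
  exists2 q, q \in s & q `<=` Q.
Proof.
move=> Ar Qp; have [[Qs QA] /eqP QnA Qmul] := Qp.
elim: s => [|q s ih] sA /= sQ; first by case: QnA; apply/seteqP.
have sA' r : r \in s -> r `<=` A by move=> rs; apply: sA; rewrite inE rs orbT.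
case: (pselect (q `<=` Q)) => qQ; first by exists q; rewrite ?mem_head.
case: ih => //; last by move=> r rs rQ; exists r; rewrite // inE rs orbT.
move=> x sx; have [a qa nQa] : exists2 a, q a & ~ Q a.
  by apply: contrapT => h; apply: qQ => a qa; apply: contrapT => nQa; apply: h; exists a.
have Aa : A a by apply: (sA q) => //; apply: mem_head.
have Ax : A x by apply: (prodm_sub Ar (submod_ring Ar) sA').
by case: (Qmul a x Aa Ax) => //; apply: sQ; apply: mem_mulm.
Qed.

Lemma maximal_prodm A Q s : is_subring A -> maximal_ideals A Q ->
  (forall q, q \in s -> maximal_ideals A q) -> prodm A s `<=` Q -> Q \in s.
Proof.
move=> Ar Qm sm sQ; have Qp := maximal_prime Ar Qm.
have [q qs qQ] := prime_prodm Ar Qp (fun q qs => maximal_sub (sm q qs)) sQ.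
by rewrite -(maximal_eq Ar (sm q qs) Qm qQ).
Qed.

Lemma comp_prodm A N M s : is_subring A -> cseries A N M s -> prodm M s `<=` N.
Proof.
move=> Ar; elim=> [_|L {}M q {}s c ih sim qE] /=; first exact: subset_refl.
have [Ls Ms _ _] := sim; rewrite -prodm_mulm.
apply: subset_trans ih; elim: (s) => [|r u ihu] /=; last exact: mulmS.
by apply: (mulm_subset Ls) => a x; rewrite qE => -[Aa]; apply.
Qed.

End Products.
(** * Divisors of fractional ideals over rings with finite length quotients *)

Section Divisors.
Context {K : fieldType}.
Implicit Types (A B I J L M N X p q : set K) (x y : K).

(** This consequence of being noetherian of dimension one passes to the
    normalization and to the local rings, so that one theory of divisors serves
    all three. *)
Definition finlen_ring A :=
  [/\ is_subring A, has_fraction_field A & forall I, is_ideal A I ->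
    (exists2 x, I x & x != 0) -> exists s, cseries A I A s].

Lemma finlen_subring A : finlen_ring A -> is_subring A.
Proof. by case. Qed.

Lemma frac_submod A M : is_fractional_ideal A M -> is_submodule A M.
Proof. by case. Qed.

Lemma frac_ring A : is_subring A -> is_fractional_ideal A A.
Proof.
move=> Ar; split; first exact: submod_ring.
  by exists 1; rewrite ?oner_neq0 //; apply: ring1.
exists 1; split; rewrite ?oner_neq0 //; first exact: ring1.
by move=> x Ax; rewrite mul1r.
Qed.

Lemma frac_mul A M N : is_subring A -> is_fractional_ideal A M ->
  is_fractional_ideal A N -> is_fractional_ideal A (mulm M N).
Proof.
move=> Ar [Ms [m Mm m0] [d [Ad d0 dM]]] [Ns [n Nn n0] [e [Ae e0 eN]]].
split; first exact: submod_mulm.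
  by exists (m * n); rewrite ?mulf_neq0 //; apply: mem_mulm.
exists (d * e); split; rewrite ?mulf_neq0 //; first exact: ringM.
suff: mulm M N `<=` [set z | A (d * e * z)] by [].
apply: mulm_min => /= [|u v|u v Mu Nv]; first by rewrite mulr0; apply: ring0.
  by rewrite mulrDr; apply: ringD.
by rewrite mulrACA; apply: ringM => //; [apply: dM|apply: eN].
Qed.

Lemma frac_scale A M x : is_subring A -> has_fraction_field A -> x != 0 ->
  is_fractional_ideal A M -> is_fractional_ideal A (principal M x).
Proof.
move=> Ar Af x0 [Ms [m Mm m0] [d [Ad d0 dM]]]; split; first exact: submod_scale.
  by exists (x * m); rewrite ?mulf_neq0 //; exists m.
have [a [b [Aa Ab b0 xE]]] := Af x; exists (b * d); split.
- exact: ringM.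
- exact: mulf_neq0.
- move=> _ [u Mu <-]; have -> : b * d * (x * u) = a * (d * u).
    by rewrite xE; field.
  by apply: ringM => //; apply: dM.
Qed.

Lemma frac_setI A M N : is_subring A -> has_fraction_field A ->
  is_fractional_ideal A M -> is_fractional_ideal A N ->
  is_fractional_ideal A (M `&` N).
Proof.
move=> Ar Af [Ms [m Mm m0] [d [Ad d0 dM]]] [Ns [n Nn n0] _].
split; first exact: submodI; last first.
  by exists d; split=> // x [Mx _]; apply: dM.
have [a [b [Aa Ab b0 mE]]] := Af m; have [c [e [Ac Ae e0 nE]]] := Af n.
exists (b * m * (e * n)).
  split; last by rewrite -mulrCA; apply: (submodM Ns) => //; apply: (submodM Ns) => //;
    rewrite mE mulrC divfK.
  rewrite mulrC; apply: (submodM Ms); first by rewrite nE mulrC divfK.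
  exact: (submodM Ms).
by rewrite !mulf_neq0.
Qed.

(** A nonzero element of J, written as a fraction, provides the common denominator
    of the elements of I. *)
Lemma inverse_frac A I J : is_subring A -> has_fraction_field A ->
  inverse_of A I J -> is_fractional_ideal A I.
Proof.
move=> Ar Af [Is Js e].
have nz M N : mulm M N = A -> exists2 x, M x & x != 0.
  move=> MN; apply: contrapT => h; have := ring1 Ar; rewrite -MN.
  suff: mulm M N `<=` [set 0] by move=> /[apply] /eqP; rewrite oner_eq0.
  apply: mulm_min => //= [_ _ -> ->|x y Mx _]; first by rewrite addr0.
  have [->|x0] := eqVneq x 0; first by rewrite mul0r.
  by case: h; exists x.
split=> //; first exact: nz e.
have [j Jj j0] : exists2 x, J x & x != 0 by apply: (nz _ I); rewrite mulmC.
have [a [b [Aa Ab b0 jE]]] := Af j; exists (b * j); split.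
- by rewrite jE mulrC divfK.
- exact: mulf_neq0.
- move=> x Ix; rewrite -mulrA; apply: ringM => //; rewrite mulrC -e.
  exact: mem_mulm.
Qed.

Lemma invertibleP A I : is_subring A -> has_fraction_field A ->
  invertible_ideals A I <-> exists J, inverse_of A I J.
Proof.
move=> Ar Af; split=> [[[Is _ _] [J [Js _ _] e]]|[J h]]; first by exists J.
split; first exact: inverse_frac h.
exists J; first exact: inverse_frac (inverse_sym h).
by case: h.
Qed.

Lemma finlen_comp A N M : finlen_ring A -> is_fractional_ideal A N ->
  is_fractional_ideal A M -> N `<=` M -> exists s, cseries A N M s.
Proof.
move=> [Ar Af fl] Nf Mf NM; have [Ms _ [d [Ad d0 dM]]] := Mf.
have [Ns [n Nn n0] _] := Nf.
have sub X : X `<=` M -> principal X d `<=` A by move=> XM _ [x /XM Mx <-]; apply: dM.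
have [||s c] := fl (principal N d).
- by split; [apply: submod_scale|apply: sub].
- by exists (d * n); rewrite ?mulf_neq0 //; exists n.
have [||s1 [s2 [c1 _ _]]] := comp_split Ar c (submod_scale d Ms).
- exact: scaleS.
- exact: sub.
exists s1; rewrite -(scaleK N d0) -(scaleK M d0).
by apply: comp_scale c1 => //; rewrite invr_neq0.
Qed.

Definition cyc A N M : {freeg (set K) / int} :=
  \sum_(q <- xget [::] [set s | cseries A N M s]) << q >>.

Lemma cycE A N M s :
  is_subring A -> cseries A N M s -> cyc A N M = \sum_(q <- s) << q >>.
Proof.
move=> Ar c; apply: perm_big; apply: (comp_uniq Ar _ c).
exact: (@xgetI _ [::] [set s | cseries A N M s] s).
Qed.

Lemma coeff_cyc A N M s p :
  is_subring A -> cseries A N M s -> coeff p (cyc A N M) = (count_mem p s)%:Z.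
Proof.
move=> Ar c; rewrite (cycE Ar c) raddf_sum /=; elim: (s) => [|q t ih]; first by rewrite big_nil.
by rewrite big_cons ih /= coeffU mul1r PoszD; congr (_ + _); case: eqP.
Qed.

Lemma cyc_refl A N : is_subring A -> is_submodule A N -> cyc A N N = 0.
Proof. by move=> Ar Ns; rewrite (cycE Ar (comp_nil Ns)) big_nil. Qed.

Lemma cyc_cat A L N M : finlen_ring A -> is_fractional_ideal A L ->
  is_fractional_ideal A N -> is_fractional_ideal A M -> L `<=` N -> N `<=` M ->
  cyc A L M = cyc A L N + cyc A N M.
Proof.
move=> Afl Lf Nf Mf LN NM; have Ar := finlen_subring Afl.
have [s c] := finlen_comp Afl Lf Nf LN; have [t c'] := finlen_comp Afl Nf Mf NM.
by rewrite (cycE Ar c) (cycE Ar c') (cycE Ar (comp_cat c c')) big_cat addrC.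
Qed.

Lemma cyc_mul A I J N M : finlen_ring A -> inverse_of A I J ->
  is_fractional_ideal A N -> is_fractional_ideal A M -> N `<=` M ->
  cyc A (mulm I N) (mulm I M) = cyc A N M.
Proof.
move=> Afl h Nf Mf NM; have Ar := finlen_subring Afl.
have [s c] := finlen_comp Afl Nf Mf NM.
by rewrite (cycE Ar c) (cycE Ar (comp_mul Ar h c)).
Qed.

Lemma Div_subgroup A (G : set {freeg (set K) / int}) : G 0 ->
  (forall D E, G D -> G E -> G (D - E)) ->
  (forall p, maximal_ideals A p -> G << p >>) -> Div A `<=` G.
Proof.
move=> G0 GB gen.
have GN D : G D -> G (- D) by move=> GD; rewrite -sub0r; apply: GB.
have GD D E : G D -> G E -> G (D + E).
  by move=> hD hE; rewrite -(opprK E); apply: GB => //; apply: GN.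
have GU p (z : int) : maximal_ideals A p -> G << z *g p >>.
  move=> /gen Gp; have Gn n : G << n%:Z *g p >>.
    elim: n => [|n ih]; first by rewrite freegU0.
    by rewrite intS -freegUD; apply: GD.
  by case: z => // n; rewrite NegzE -freegUN; apply: GN.
move=> D hD; rewrite -(freeg_sumE D) big_seq; elim/big_ind: _ => // p.
by rewrite mem_dom => /hD; apply: GU.
Qed.

(** The generalized index of two lattices, which need not contain one another. *)
Definition idx A N M := cyc A (N `&` M) N - cyc A (N `&` M) M.

Section FiniteLength.
Variables (A : set K) (Afl : finlen_ring A).
Let Ar : is_subring A. Proof. exact: finlen_subring Afl. Qed.
Let Af : has_fraction_field A. Proof. by case: Afl. Qed.
Let As := submod_ring Ar.
Let Afrac := frac_ring Ar.

Lemma idx_sub L N M : is_fractional_ideal A L -> is_fractional_ideal A N ->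
  is_fractional_ideal A M -> L `<=` N -> L `<=` M ->
  idx A N M = cyc A L N - cyc A L M.
Proof.
move=> Lf Nf Mf LN LM; have If := frac_setI Ar Af Nf Mf.
have LI : L `<=` N `&` M by move=> x Lx; split; [apply: LN|apply: LM].
rewrite (cyc_cat Afl Lf If Nf LI (@subIsetl _ _ _)).
rewrite (cyc_cat Afl Lf If Mf LI (@subIsetr _ _ _)) /idx.
by rewrite opprD addrACA subrr add0r.
Qed.

Lemma idx_refl N : is_fractional_ideal A N -> idx A N N = 0.
Proof. by move=> [Ns _ _]; rewrite /idx subrr. Qed.

Lemma idx_trans L N M : is_fractional_ideal A L -> is_fractional_ideal A N ->
  is_fractional_ideal A M -> idx A L N + idx A N M = idx A L M.
Proof.
move=> Lf Nf Mf; have Xf := frac_setI Ar Af Lf (frac_setI Ar Af Nf Mf).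
have XL : L `&` (N `&` M) `<=` L by move=> x [].
have XN : L `&` (N `&` M) `<=` N by move=> x [_ []].
have XM : L `&` (N `&` M) `<=` M by move=> x [_ []].
rewrite (idx_sub Xf Lf Nf) // (idx_sub Xf Nf Mf) // (idx_sub Xf Lf Mf) //.
by rewrite addrA subrK.
Qed.

Lemma idx_mul I J N M : inverse_of A I J -> is_fractional_ideal A N ->
  is_fractional_ideal A M -> idx A (mulm I N) (mulm I M) = idx A N M.
Proof.
move=> h Nf Mf; have Hf := inverse_frac Ar Af h.
have Xf := frac_setI Ar Af Nf Mf.
have XN : N `&` M `<=` N by move=> x [].
have XM : N `&` M `<=` M by move=> x [].
rewrite (@idx_sub (mulm I (N `&` M))); try exact: frac_mul.
- by rewrite (cyc_mul Afl h Xf Nf XN) (cyc_mul Afl h Xf Mf XM).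
- exact: mulmS.
- exact: mulmS.
Qed.

(** The divisor of a fractional ideal, effective when it is contained in A. *)
Definition chi M := idx A A M.

Lemma chi_ring : chi A = 0.
Proof. exact: idx_refl. Qed.

Lemma chi_ideal I : is_fractional_ideal A I -> I `<=` A -> chi I = cyc A I A.
Proof.
by move=> If IA; rewrite /chi (idx_sub If) // (cyc_refl Ar (frac_submod If)) subr0.
Qed.

Lemma chi_mul I J M : inverse_of A I J -> is_fractional_ideal A M ->
  chi (mulm I M) = chi I + chi M.
Proof.
move=> h Mf; have If := inverse_frac Ar Af h.
rewrite /chi -(@idx_trans A I (mulm I M)) //; last exact: frac_mul.
by rewrite -{2}(mulm_ringr Ar (frac_submod If)) (idx_mul h).
Qed.

Lemma chi_inv I J : inverse_of A I J -> chi J = - chi I.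
Proof.
move=> h; apply/eqP; rewrite -addr_eq0 addrC; apply/eqP.
rewrite -(chi_mul h); last exact: inverse_frac (inverse_sym h).
by case: h => _ _ ->; apply: chi_ring.
Qed.

Lemma chi_scale x M : x != 0 -> is_fractional_ideal A M ->
  chi (principal M x) = chi (principal A x) + chi M.
Proof.
move=> x0 Mf; rewrite -(mulm_principal x Ar (frac_submod Mf)).
by rewrite (chi_mul (inverse_scale Ar x0)).
Qed.

Lemma chi_Div M : is_fractional_ideal A M -> Div A (chi M).
Proof.
move=> Mf p; rewrite /chi /idx coeffB; have If := frac_setI Ar Af Afrac Mf.
have [s c] := finlen_comp Afl If Afrac (@subIsetl _ _ _).
have [t c'] := finlen_comp Afl If Mf (@subIsetr _ _ _).
rewrite (coeff_cyc _ Ar c) (coeff_cyc _ Ar c').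
case: (boolP (p \in s)) => [/(comp_maximal Ar c) //|ps].
case: (boolP (p \in t)) => [/(comp_maximal Ar c') //|pt].
by rewrite (count_memPn ps) (count_memPn pt) subrr eqxx.
Qed.

(** The divisors of invertible ideals form a group, so they are all divisors as
    soon as every maximal ideal is one of them. *)
Lemma chi_surj : (forall p, maximal_ideals A p ->
    exists2 M, invertible_ideals A M & chi M = << p >>) ->
  forall D, Div A D -> exists2 M, invertible_ideals A M & chi M = D.
Proof.
move=> gen D; pose G D := exists2 M, invertible_ideals A M & chi M = D.
apply: (@Div_subgroup A G) => //; rewrite /G.
  exists A; last exact: chi_ring.
  by apply/invertibleP => //; exists A; split=> //; rewrite mulm_ring.
move=> _ _ [M /(invertibleP _ Ar Af)[M' h] <-] [N /(invertibleP _ Ar Af)[N' h'] <-].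
exists (mulm M N').
  by apply/invertibleP => //; exists (mulm M' N); apply: inverse_mul (inverse_sym h').
rewrite (chi_mul h) ?(chi_inv h') //.
exact: inverse_frac (inverse_sym h').
Qed.

End FiniteLength.

End Divisors.
(** * Localization and orders *)

Section Localization.
Context {K : fieldType}.
Implicit Types (A B I J L M N X p q : set K) (x y : K).

Lemma composition_seriesP A N M n : is_subring A ->
  (exists S, composition_series A M N n S) <->
  exists2 s, cseries A N M s & size s = n.
Proof.
move=> Ar; split=> [[S [S0 Sn Ss step]]|].
  rewrite -Sn -S0; move: step Ss {S0 Sn}; elim: n => [|n ih] step Ss.
    by exists [::] => //; apply: comp_nil; apply: Ss.
  have [i ni|i ni|s c sz] := ih.
  - by apply: step; apply: leq_trans ni _.
  - by apply: Ss; apply: leq_trans ni _.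
  have [lt mid] := step n (leqnn _).
  have sim : simple A (S n) (S n.+1) by split=> //; apply: Ss.
  by exists (colon A (S n) (S n.+1) :: s); [apply: comp_cons c sim erefl|rewrite /= sz].
move=> [s c <-] {n}; elim: c => [Ns|L {}M q {}s c [S [S0 Sn Ss step]] sim _].
  by exists (fun=> N); split.
have [_ Ms LM mid] := sim.
exists (fun i => if (i <= size s)%N then S i else M); split=> //=.
- by rewrite ltnn.
- by move=> i _; case: ifP => // /Ss.
- move=> i; case: (ltnP i (size s)) => [ni _|ni si].
    by rewrite (ltnW ni); apply: step.
  have -> : i = size s by apply/eqP; rewrite eqn_leq ni andbT -ltnS.
  by rewrite leqnn Sn; split.
Qed.

Lemma lenE A N M s : is_subring A -> cseries A N M s -> len A M N = size s.
Proof.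
move=> Ar c; rewrite /len.
have: [set n | exists S, composition_series A M N n S] (size s).
  by apply/(composition_seriesP _ _ _ Ar); exists s.
move=> /(xgetI 0%N) /(composition_seriesP _ _ _ Ar)[t c' <-].
exact: perm_size (comp_uniq Ar c' c).
Qed.

Section AtMaximal.
Variables (A p : set K) (Ar : is_subring A) (pm : maximal_ideals A p).
Let Ap := localize A p A.
Let pA := maximal_sub pm.
Let ps := maximal_submod pm.

Lemma unit_neq0 s : (A `\` p) s -> s != 0.
Proof. by move=> [_ nps]; apply/eqP => s0; apply: nps; rewrite s0; apply: submod0 ps. Qed.

Lemma unit1 : (A `\` p) 1.
Proof. by split; [apply: ring1|apply: (maximal_not1 Ar pm)]. Qed.

Lemma unitM s t : (A `\` p) s -> (A `\` p) t -> (A `\` p) (s * t).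
Proof.
move=> [As ns] [At nt]; split; first exact: ringM.
by have [_ _ pr] := maximal_prime Ar pm; move=> /pr[].
Qed.

Lemma loc_sub M : M `<=` localize A p M.
Proof. by move=> x Mx; exists x => //; exists 1; rewrite ?divr1 //; apply: unit1. Qed.

Lemma loc_ring : is_subring Ap.
Proof.
split; first by rewrite inE; apply: loc_sub; apply: ring1.
- move=> x y; rewrite !inE => -[a Aa [s Ss <-]] [b Ab [t St <-]].
  exists (a * t - b * s); first by case: Ss St => ? _ [? _]; apply: ringB => //; apply: ringM.
  exists (s * t); first exact: unitM.
  by have s0 := unit_neq0 Ss; have t0 := unit_neq0 St; field; rewrite s0 t0.
- move=> x y; rewrite !inE => -[a Aa [s Ss <-]] [b Ab [t St <-]].
  exists (a * b); first exact: ringM.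
  by exists (s * t); [exact: unitM|rewrite mulf_div].
Qed.

Lemma loc_submod M : is_submodule A M -> is_submodule Ap (localize A p M).
Proof.
move=> Ms; split; first by apply: loc_sub; apply: submod0 Ms.
- move=> _ _ [a Aa [s Ss <-]] [b Ab [t St <-]].
  exists (t * a + s * b).
    by case: Ss St => ? _ [? _]; apply: (submodD Ms); apply: (submodM Ms).
  exists (s * t); first exact: unitM.
  by have s0 := unit_neq0 Ss; have t0 := unit_neq0 St; field; rewrite s0 t0.
- move=> _ _ [a Aa [s Ss <-]] [b Ab [t St <-]].
  exists (a * b); first exact: (submodM Ms).
  by exists (s * t); [exact: unitM|rewrite mulf_div].
Qed.

Lemma loc_absorb X : is_submodule Ap X -> localize A p X = X.
Proof.
move=> Xs; apply/seteqP; split; last exact: loc_sub.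
move=> _ [x Xx [s Ss <-]]; rewrite mulrC; apply: (submodM Xs) => //.
by exists 1; [apply: ring1|exists s; rewrite ?mul1r].
Qed.

Lemma locS M N : M `<=` N -> localize A p M `<=` localize A p N.
Proof. by move=> MN _ [x /MN Nx [s Ss <-]]; exists x => //; exists s. Qed.

Lemma loc_scale M x : localize A p (principal M x) = principal (localize A p M) x.
Proof.
apply/seteqP; split=> [_ [_ [m Mm <-] [s Ss <-]]|_ [_ [m Mm [s Ss <-]] <-]].
  by exists (m / s); [exists m => //; exists s|rewrite mulrA].
by exists (x * m); [exists m|exists s; rewrite ?mulrA].
Qed.

Lemma loc_simple_other L M : simple A L M -> colon A L M <> p ->
  localize A p M = localize A p L.
Proof.
move=> sim qp; have [Ls Ms [LM _] _] := sim.
have [t [At Lt] nt] : exists2 t, colon A L M t & ~ p t.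
  apply: contrapT => h; apply: qp; apply: (maximal_eq Ar (colon_maximal Ar sim) pm).
  by move=> t qt; apply: contrapT => nt; apply: h; exists t.
apply/seteqP; split; last exact: locS.
move=> _ [x Mx [s Ss <-]]; exists (t * x); first exact: Lt.
have St : (A `\` p) t by [].
exists (t * s); first exact: unitM.
by have s0 := unit_neq0 Ss; have t0 := unit_neq0 St; field; rewrite s0 t0.
Qed.

Lemma loc_simple L M : simple A L M -> colon A L M = p ->
  simple Ap (localize A p L) (localize A p M).
Proof.
move=> sim qE; have [Ls Ms [LM nML] mid] := sim.
have desc t x : (A `\` p) t -> M x -> L (t * x) -> L x.
  move=> [At nt] Mx Ltx; have [b [c [Ab pc e]]] := maximal_comax Ar pm At nt.
  rewrite -(mul1r x) -e mulrDl; apply: (submodD Ls).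
    by rewrite -mulrA; apply: (submodM Ls).
  by move: pc; rewrite -qE => -[_]; apply.
split; [exact: loc_submod|exact: loc_submod| |].
  split; first exact: locS.
  move=> h; apply: nML => x Mx; have [l Ll [t St xE]] := h _ (loc_sub Mx).
  apply: (desc t x) => //.
  by rewrite -xE mulrC divfK //; apply: unit_neq0.
move=> X Xs LX XM; have AAp : A `<=` Ap by exact: loc_sub.
have XsA := submod_restrict AAp Xs.
have eX : X = localize A p (X `&` M).
  apply/seteqP; split=> [x Xx|]; last first.
    by move=> _ [x [Xx Mx] [s Ss <-]]; rewrite -(loc_absorb Xs); exists x => //; exists s.
  have [m Mm [s Ss xE]] := XM _ Xx; exists m; last by exists s.
  split=> //; have -> : m = s * x.
    by rewrite -xE mulrC divfK //; apply: unit_neq0.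
  by apply: (submodM XsA) => //; case: Ss.
case: (mid (X `&` M)).
- exact: submodI.
- move=> x Lx; split; last exact: LM.
  by apply: LX; apply: loc_sub.
- by move=> x [].
- by move=> e; left; rewrite eX e.
- by move=> e; right; rewrite eX e.
Qed.

(** Localizing kills the simple quotients with annihilator other than p and
    keeps the others simple. *)
Lemma comp_loc N M s : cseries A N M s ->
  exists2 t, cseries Ap (localize A p N) (localize A p M) t & size t = count_mem p s.
Proof.
elim=> [Ns|L {}M q {}s c [t ct sz] sim qE].
  by exists [::] => //; apply: comp_nil; apply: loc_submod.
case: (pselect (q = p)) => qp; rewrite /=.
  rewrite qp in qE; rewrite qp eqxx -sz.
  by eexists (_ :: t) => //; apply: comp_cons ct (loc_simple sim (esym qE)) erefl.
have /eqP/negbTE -> := qp; exists t => //.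
by rewrite (loc_simple_other sim) // -qE.
Qed.

Lemma len_loc N M s : cseries A N M s ->
  len Ap (localize A p M) (localize A p N) = count_mem p s.
Proof. by move=> /comp_loc[t c <-]; apply: lenE loc_ring c. Qed.

End AtMaximal.

Section Orders.
Variables (A : set K) (Afl : finlen_ring A).
Let Ar : is_subring A. Proof. exact: finlen_subring Afl. Qed.
Let Af : has_fraction_field A. Proof. by case: Afl. Qed.
Let As := submod_ring Ar.
Let Afrac := frac_ring Ar.

Lemma principal_frac x : x != 0 -> is_fractional_ideal A (principal A x).
Proof. by move=> x0; apply: frac_scale. Qed.

Lemma coeff_cyc_len p N M : maximal_ideals A p -> is_fractional_ideal A N ->
  is_fractional_ideal A M -> N `<=` M ->
  coeff p (cyc A N M) = (len (localize A p A) (localize A p M) (localize A p N))%:Z.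
Proof.
move=> pm Nf Mf NM; have [s c] := finlen_comp Afl Nf Mf NM.
by rewrite (len_loc Ar pm c) (coeff_cyc _ Ar c).
Qed.

(** The coefficients at p of the cycles of M and N over their intersection are
    lengths of localized quotients, which only depend on the localizations. *)
Lemma coeff_chi_loc p M N : maximal_ideals A p -> is_fractional_ideal A M ->
  is_fractional_ideal A N -> localize A p M = localize A p N ->
  coeff p (chi A M) = coeff p (chi A N).
Proof.
move=> pm Mf Nf e; rewrite /chi -(idx_trans Afl Afrac Nf Mf) raddfD /=.
have If := frac_setI Ar Af Nf Mf.
rewrite [X in _ + X](_ : _ = 0) ?addr0 // /idx coeffB.
rewrite (coeff_cyc_len pm If Nf (@subIsetl _ _ _)).
by rewrite (coeff_cyc_len pm If Mf (@subIsetr _ _ _)) e subrr.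
Qed.

Lemma chi_frac a b : A a -> a != 0 -> A b -> b != 0 ->
  chi A (principal A (a / b)) = cyc A (principal A a) A - cyc A (principal A b) A.
Proof.
move=> Aa a0 Ab b0; have sub c : A c -> principal A c `<=` A by apply: scale_sub.
have pf c : c != 0 -> is_fractional_ideal A (principal A c) by apply: principal_frac.
have ab0 : a / b != 0 by rewrite mulf_neq0 ?invr_neq0.
rewrite -(chi_ideal Afl (pf _ a0) (sub _ Aa)) -(chi_ideal Afl (pf _ b0) (sub _ Ab)).
have {2}-> : a = b * (a / b) by rewrite mulrC divfK.
by rewrite -[principal A (b * _)]scale_mul (chi_scale Afl b0 (pf _ ab0)) addrC addKr.
Qed.

Lemma coeff_chi_frac p a b : maximal_ideals A p ->
  A a -> a != 0 -> A b -> b != 0 -> let Ap := localize A p A in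
  coeff p (chi A (principal A (a / b))) =
  (len Ap Ap (principal Ap a))%:Z - (len Ap Ap (principal Ap b))%:Z.
Proof.
move=> pm Aa a0 Ab b0 Ap; rewrite chi_frac // coeffB.
have sub c : A c -> principal A c `<=` A by apply: scale_sub.
have pf c : c != 0 -> is_fractional_ideal A (principal A c) by apply: principal_frac.
rewrite (coeff_cyc_len pm (pf _ a0) Afrac (sub _ Aa)).
by rewrite (coeff_cyc_len pm (pf _ b0) Afrac (sub _ Ab)) !loc_scale.
Qed.

(** The fraction chosen in the definition of the order is irrelevant, since chi is
    additive on principal ideals. *)
Lemma ordE p x : maximal_ideals A p -> x != 0 ->
  ord A p x = coeff p (chi A (principal A x)).
Proof.
move=> pm x0; rewrite /ord; set S := [set _ | _].
have [a [b [Aa Ab b0 xE]]] := Af x.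
have: S (xget (0, 1) S) by apply: (@xgetI _ _ S (a, b)).
case: (xget _ S) => {Aa Ab b0 xE}a {}b /= [Aa Ab b0 xE].
have a0 : a != 0 by apply: contraNneq x0 => a0; rewrite xE a0 mul0r.
by rewrite xE coeff_chi_frac.
Qed.

(** The sum over all maximal ideals only has finitely many nonzero terms, because
    an element of the free group has finite support; otherwise the sum would be
    the default value 0. *)
Lemma Div_fsum (f : set K -> int) D : Div A D ->
  (forall p, maximal_ideals A p -> f p = coeff p D) ->
  \sum_(p \in maximal_ideals A) << f p *g p >> = D.
Proof.
move=> hD fE; rewrite -[RHS]freeg_sumE.
rewrite (eq_fsbigr (fun p => << coeff p D *g p >>)); last first.
  by move=> p; rewrite inE => /fE ->.
rewrite (fsbigE (dom D)); first last.
- by move=> p _ pD; rewrite (coeff_outdom pD) freegU0.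
- by move=> p /=; rewrite mem_dom => /hD.
- exact: uniq_dom.
rewrite big_mkcond [RHS]big_seq [LHS]big_seq; apply: eq_bigr => p.
by rewrite mem_dom => /hD h; rewrite ifT // inE.
Qed.

Lemma div_eltE x : x != 0 -> div_elt A x = chi A (principal A x).
Proof.
move=> x0; apply: Div_fsum; first by apply: chi_Div => //; apply: principal_frac.
by move=> p pm; apply: ordE.
Qed.

(** If 1 is the sum of the u v with u in I and v in its inverse J, then some
    product u v is a unit at p, and that u generates I at p. *)
Lemma invertible_loc p I J : maximal_ideals A p -> inverse_of A I J ->
  exists2 x, x != 0 & localize A p I = principal (localize A p A) x.
Proof.
move=> pm [Is Js e]; have := ring1 Ar; rewrite -{1}e => -[s sIJ s1].
have [u us nu] : exists2 u, u \in s & ~ p (u.1 * u.2).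
  apply: contrapT => h; apply: (maximal_not1 Ar pm); rewrite s1 big_seq.
  apply: (submod_sum _ (maximal_submod pm)) => u us.
  by apply: contrapT => nu; apply: h; exists u.
have [Iu Ju] := sIJ u us.
have Su : (A `\` p) (u.1 * u.2) by split=> //; rewrite -e; apply: mem_mulm.
have := unit_neq0 pm Su; rewrite mulf_eq0 negb_or => /andP[u10 u20].
exists u.1 => //; rewrite -loc_scale; apply/seteqP; split; last first.
  by apply: locS; apply: (scale_sub Is).
move=> _ [x Ix [t St <-]]; exists (u.1 * (x * u.2)).
  by exists (x * u.2) => //; rewrite -e; apply: mem_mulm.
exists (u.1 * u.2 * t); first exact: unitM.
by have t0 := unit_neq0 pm St; field; rewrite t0 u10 u20.
Qed.

Lemma div_idealE M : invertible_ideals A M -> div_ideal A M = chi A M.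
Proof.
move=> /(invertibleP _ Ar Af)[J h]; have Mf := inverse_frac Ar Af h.
apply: Div_fsum; first exact: chi_Div.
move=> p pm; rewrite /local_generator; set S := [set _ | _].
have [x x0 xE] := invertible_loc pm h.
have [g0 gE] : S (xget 0 S) by apply: (@xgetI _ _ S x).
rewrite ordE //; apply: (coeff_chi_loc pm) => //; first exact: principal_frac.
by rewrite loc_scale.
Qed.

End Orders.

(** * Local rings *)

Section LocalRing.
Variables (A p : set K) (Afl : finlen_ring A) (pm : maximal_ideals A p).
Let Ar : is_subring A. Proof. exact: finlen_subring Afl. Qed.
Let Af : has_fraction_field A. Proof. by case: Afl. Qed.
Let Ap := localize A p A.
Let m := localize A p p.
Let Apr : is_subring Ap := loc_ring Ar pm.
Let ps := maximal_submod pm.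
Let pA := maximal_sub pm.
Let AAp : A `<=` Ap := loc_sub Ar pm (M := A).

Lemma loc_unit s : Ap s -> ~ m s -> Ap s^-1.
Proof.
move=> [a Aa [t St <-]] nm; exists t; first by case: St.
exists a; last by rewrite invf_div.
by split=> // pa; apply: nm; exists a => //; exists t.
Qed.

Lemma loc_not1 : ~ m 1.
Proof.
move=> [a pa [t St e]]; have [_ nt] := St; apply: nt.
by rewrite -(mul1r t) -e divfK //; apply: unit_neq0 St.
Qed.

Lemma loc_ideal_sub I : is_ideal Ap I -> ~ I 1 -> I `<=` m.
Proof.
move=> [Is IA] nI1 x Ix; apply: contrapT => nmx; apply: nI1.
have x0 : x != 0.
  by apply/eqP => x0; apply: nmx; rewrite x0; apply: submod0 (loc_submod Ar pm ps).
by rewrite -(mulVf x0); apply: (submodM Is) => //; apply: loc_unit => //; apply: IA.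
Qed.

Lemma loc_maximal : maximal_ideals Ap m.
Proof.
have mi : is_ideal Ap m by split; [apply: loc_submod|apply: locS].
split=> //; first by apply/eqP => e; apply: loc_not1; rewrite e; apply: ring1.
move=> I Ii mI; case: (pselect (I 1)) => I1; [right|left]; apply/seteqP; split=> //.
- by case: Ii.
- by move=> x Ax; rewrite -(mulr1 x); case: Ii => Is _; apply: (submodM Is).
- exact: loc_ideal_sub.
Qed.

Lemma loc_maximal_uniq q : maximal_ideals Ap q -> q = m.
Proof.
move=> qm; apply: (maximal_eq Apr qm loc_maximal).
by apply: loc_ideal_sub; [case: qm|apply: maximal_not1 qm].
Qed.

Lemma loc_loc : localize Ap m Ap = Ap.
Proof.
apply/seteqP; split; last exact: loc_sub loc_maximal _.
by move=> _ [x Ax [s [As ns] <-]]; apply: ringM => //; apply: loc_unit.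
Qed.

(** An ideal I of the local ring is the localization of its trace on A, whose
    composition series localizes to one for I. *)
Lemma loc_finlen : finlen_ring Ap.
Proof.
split=> //.
  by move=> x; have [a [b [Aa Ab b0 xE]]] := Af x; exists a, b; split=> //; apply: AAp.
move=> I [Is IA] [x Ix x0]; have [a Aa [t St xE]] := IA _ Ix; rewrite -{}xE in Ix x0.
have IsA := submod_restrict AAp Is.
have [_ _ fl] := Afl; have [||s c] := fl (I `&` A).
- by split; [apply: submodI => //; apply: submod_ring|move=> z []].
- exists a; last by apply: contraNneq x0 => ->; rewrite mul0r.
  split=> //; have -> : a = t * (a / t) by rewrite mulrC divfK //; apply: unit_neq0 St.
  by apply: (submodM IsA) => //; case: St.
have [u cu _] := comp_loc Ar pm c; exists u.
have <- // : localize A p (I `&` A) = I.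
apply/seteqP; split.
  by rewrite -{2}(loc_absorb Ar pm Is); apply: locS => z [].
move=> y Iy; have [b Ab [r Sr yE]] := IA _ Iy; exists b; last by exists r.
split=> //; have -> : b = r * y by rewrite -yE mulrC divfK //; apply: unit_neq0 Sr.
by apply: (submodM IsA) => //; case: Sr.
Qed.

Lemma ord_loc x : x != 0 -> ord Ap m x = ord A p x.
Proof.
move=> x0; rewrite (ordE loc_finlen loc_maximal x0) (ordE Afl pm x0).
have [a [b [Aa Ab b0 xE]]] := Af x.
have a0 : a != 0 by apply: contraNneq x0 => a0; rewrite xE a0 mul0r.
rewrite xE (coeff_chi_frac Afl) // (coeff_chi_frac loc_finlen loc_maximal) ?loc_loc //.
- exact: AAp.
- exact: AAp.
Qed.

End LocalRing.

End Localization.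
(** * One-dimensional noetherian domains have finite length quotients *)

Section Noetherian.
Context {K : fieldType}.
Implicit Types (A B I J L M N X p q : set K) (x y : K).

Lemma span_submod A n (s : 'I_n -> K) :
  is_subring A -> is_submodule A (module_span A s).
Proof.
move=> Ar; split.
- exists (fun=> 0); first by move=> _; apply: ring0.
  by rewrite big1 // => i _; rewrite mul0r.
- move=> _ _ [c Ac ->] [d Ad ->]; exists (fun i => c i + d i).
    by move=> i; apply: ringD.
  by rewrite -big_split; apply: eq_bigr => i _; rewrite mulrDl.
- move=> a _ Aa [c Ac ->]; exists (fun i => a * c i); first by move=> i; apply: ringM.
  by rewrite mulr_sumr; apply: eq_bigr => i _; rewrite mulrA.
Qed.

Lemma span_gen A n (s : 'I_n -> K) i : is_subring A -> module_span A s (s i).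
Proof.
move=> Ar; exists (fun j => (j == i)%:R).
  by move=> j; case: eqP => _; [apply: ring1|apply: ring0].
rewrite (bigD1 i) //= eqxx mul1r big1 ?addr0 // => j /negbTE ->.
by rewrite mul0r.
Qed.

Lemma span_min A n (s : 'I_n -> K) X :
  is_submodule A X -> (forall i, X (s i)) -> module_span A s `<=` X.
Proof.
move=> Xs sX _ [c Ac ->]; apply: (submod_sum _ Xs) => i _.
exact: (submodM Xs).
Qed.

(** If there were no maximal ideal I with the property, repeatedly choosing a
    larger one would give a strictly increasing sequence, whose union is finitely
    generated and hence equal to one of its terms. *)
Lemma noetherian_max A (P : set K -> Prop) I0 : is_subring A -> is_noetherian A ->
  is_ideal A I0 -> P I0 ->
  exists I, [/\ is_ideal A I, P I &
    forall J, is_ideal A J -> P J -> I `<=` J -> J = I].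
Proof.
move=> Ar noeth I0i PI0; apply: contrapT => nomax.
pose G I := is_ideal A I /\ P I.
pose f I := xget I [set J | G J /\ (I `<=` J /\ J <> I)].
have fP I : G I -> G (f I) /\ (I `<=` f I /\ f I <> I).
  move=> [Ii PI]; apply: (@xgetPex _ I [set J | G J /\ (I `<=` J /\ J <> I)]).
  apply: contrapT => h; apply: nomax; exists I; split=> // J Ji PJ IJ.
  by apply: contrapT => JI; apply: h; exists J.
pose c n := iter n f I0.
have cG n : G (c n) by elim: n => [//|n /fP[]].
have cS m n : (m <= n)%N -> c m `<=` c n.
  elim: n => [|n ih]; first by rewrite leqn0 => /eqP ->; apply: subset_refl.
  rewrite leq_eqVlt => /predU1P[->|]; first exact: subset_refl.
  by rewrite ltnS => /ih h; apply: subset_trans h _; have [_ []] := fP _ (cG n).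
pose U := [set x | exists n, c n x].
have Us : is_submodule A U.
  split; first by exists 0%N; apply: submod0 I0i.1.
    move=> x y [m cx] [n cy]; exists (maxn m n); have [[cs _] _] := cG (maxn m n).
    by apply: (submodD cs); [apply: cS cx|apply: cS cy]; rewrite ?leq_maxl ?leq_maxr.
  move=> a x Aa [n cx]; exists n; have [[cs _] _] := cG n; exact: (submodM cs).
have [|n [s UE]] := noeth U.
  by split=> // x [n]; have [[_ cA] _] := cG n; apply: cA.
have /choice[h hP] i : exists n, c n (s i).
  by have: U (s i) by rewrite UE; apply: span_gen.
have Uc : U `<=` c (\max_i h i).
  have [[cs _] _] := cG (\max_i h i).
  by rewrite UE; apply: (span_min cs) => i; apply: cS (hP i); apply: leq_bigmax.
have [_ [sub neq]] := fP _ (cG (\max_i h i)); apply: neq.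
apply/seteqP; split=> // x fx; apply: Uc.
by exists (\max_i h i).+1.
Qed.

Lemma maximal_simple A p : is_subring A -> maximal_ideals A p ->
  simple A p A /\ colon A p A = p.
Proof.
move=> Ar pm; have ps := maximal_submod pm; have n1 := maximal_not1 Ar pm.
have [|sim e] := simple_addx Ar pm ps n1; first by move=> a; rewrite mulr1.
have As := submod_ring Ar.
by move: sim e; rewrite scale1 addmC (addm_absorb As ps (maximal_sub pm)).
Qed.

Lemma noetherian_sub_maximal A I : is_subring A -> is_noetherian A ->
  is_ideal A I -> I <> A -> exists2 Q, maximal_ideals A Q & I `<=` Q.
Proof.
move=> Ar noeth Ii IA; have I1 := ideal_proper Ar Ii IA.
have [|Q [Qi [IQ Q1] Qmax]] :=
  @noetherian_max A (fun J => I `<=` J /\ ~ J 1) I Ar noeth Ii.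
  by split=> //; apply: subset_refl.
exists Q => //; split=> //; first by apply/eqP => e; apply: Q1; rewrite e; apply: ring1.
move=> J Ji QJ; case: (pselect (J 1)) => J1; last first.
  by left; apply: Qmax => //; split=> //; apply: subset_trans QJ.
right; apply: contrapT => JA; exact: (ideal_proper Ar Ji JA).
Qed.

(** A maximal counterexample I is not a maximal ideal, so, all nonzero primes
    being maximal, it is not prime: a b is in I for some a, b outside I.  Then
    I + aA and (I : a) are larger than I, hence of finite colength, and
    multiplication by a identifies A / (I : a) with (I + aA) / I. *)
Theorem noetherian_dim1_finlen A : is_subring A -> has_fraction_field A ->
  is_noetherian A -> has_krull_dim A 1 -> finlen_ring A.
Proof.
move=> Ar Af noeth [_ dim]; split=> // I0 I0i I00; apply: contrapT => bad0.
pose bad I := (exists2 x, I x & x != 0) /\ ~ (exists s, cseries A I A s).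
have [I [Ii [[x Ix x0] nI] Imax]] := noetherian_max Ar noeth I0i (conj I00 bad0 : bad I0).
have [Is IA] := Ii; have As := submod_ring Ar.
have good J : is_ideal A J -> I `<=` J -> J <> I -> exists s, cseries A J A s.
  move=> Ji IJ JI; apply: contrapT => nJ; apply: JI; apply: Imax => //; split=> //.
  by exists x => //; apply: IJ.
have IneqA : I <> A by move=> e; apply: nI; rewrite e; exists [::]; apply: comp_nil.
have nI1 := ideal_proper Ar Ii IneqA.
have [Q Qm IQ] := noetherian_sub_maximal Ar noeth Ii IneqA.
have nprime : ~ is_prime A I.
  move=> Ip; case: (pselect (I = Q)) => IeQ.
    have [sim _] := maximal_simple Ar Qm; apply: nI; rewrite IeQ.
    by exists [:: colon A Q A]; apply: comp_single.
  apply: dim; exists (fun n => match n with 0%N => [set 0] | 1%N => I | _ => Q end).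
  have Z : is_prime A [set 0].
    split; last by move=> a b _ _ /= /eqP; rewrite mulf_eq0 => /orP[]/eqP; [left|right].
      split; last by move=> _ ->; apply: ring0.
      by split=> //= [_ _ -> ->|a _ _ ->]; rewrite ?addr0 ?mulr0.
    by apply/eqP => e; have := ring1 Ar; rewrite -e => /eqP; rewrite oner_eq0.
  split=> [[|[|[|]]]|[|[|]]] //= _; first exact: maximal_prime.
    split; first by move=> _ ->; apply: submod0 Is.
    by move=> /(_ _ Ix) /= /eqP; apply/negP.
  by split=> // QI; apply: IeQ; apply/seteqP.
have [a [b [Aa Ab Iab na nb]]] : exists a b, [/\ A a, A b, I (a * b), ~ I a & ~ I b].
  apply: contrapT => h; apply: nprime; split=> //; first exact/eqP.
  move=> a b Aa Ab Iab; case: (pselect (I a)) => [|na]; [by left|right].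
  by apply: contrapT => nb; apply: h; exists a, b.
have a0 : a != 0 by apply/eqP => a0; apply: na; rewrite a0; apply: submod0 Is.
have aAs := submod_scale a As.
have [|||s1 c1] := good (addm I (principal A a)).
- split; first exact: submod_add.
  by apply: (addm_min As) => //; apply: (scale_sub As).
- exact: addm_subl aAs.
- by move=> e; apply: na; rewrite -e; apply: (addm_subr Is); apply: mem_scale.
(* J = (I : a), which contains b *)
pose J := [set y | A y /\ I (a * y)].
have [|||s2 c2] := good J.
- split; last by move=> y [].
  split; first by split; [apply: ring0|rewrite mulr0; apply: submod0 Is].
    by move=> y z [Ay ay] [Az az]; split; [apply: ringD|rewrite mulrDr; apply: (submodD Is)].
  move=> d y Ad [Ay ay]; split; first exact: ringM.
  by rewrite mulrCA; apply: (submodM Is).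
- by move=> y Iy; split; [apply: IA|apply: (submodM Is)].
- by move=> e; apply: nb; rewrite -e.
have JE : principal J a = principal A a `&` I.
  apply/seteqP; split=> [_ [y [Ay Iay] <-]|_ [[y Ay <-] Iay]]; last by exists y.
  by split=> //; exists y.
have := comp_scale Ar a0 c2; rewrite JE => /(comp_quotient Ar Is)[t ct _].
by apply: nI; exists (s1 ++ t); apply: comp_cat c1; rewrite addmC.
Qed.

End Noetherian.

(** * Integral elements *)

Section Integrality.
Context {K : fieldType}.
Implicit Types (A B I J L M N X p q : set K) (x y : K).

Definition ring_pred A (Ar : is_subring A) : {pred K} := [in A].
HB.instance Definition _ A (Ar : is_subring A) :=
  GRing.isSubringClosed.Build K (ring_pred Ar) Ar.

Lemma char_poly_over A n (C : 'M[K]_n) : is_subring A ->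
  (forall i j, A (C i j)) -> char_poly C \is a polyOver [in A].
Proof.
move=> Ar AC; rewrite -[[in A]]/(ring_pred Ar : {pred K}).
apply: rpred_sum => s _; apply: rpredM; first by rewrite rpredX // rpredN rpred1.
apply: rpred_prod => i _; rewrite !mxE rpredB //; last first.
  by rewrite polyOverC; apply: mem_set.
by rewrite rpredMn // polyOverX.
Qed.

Lemma polyOver_coef A (q : {poly K}) i :
  is_subring A -> q \is a polyOver [in A] -> A q`_i.
Proof.
move=> Ar /allP qA; case: (ltnP i (size q)) => qi; first by have := qA _ (mem_nth 0 qi); rewrite inE.
by rewrite nth_default //; apply: ring0.
Qed.

(** The determinant trick: x is a root of the characteristic polynomial of its
    action on the generators. *)
Lemma span_integral A n (s : 'I_n -> K) x : is_subring A ->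
  (exists i, s i != 0) -> (forall i, module_span A s (x * s i)) ->
  normalization A x.
Proof.
move=> Ar [i0 si0] xs.
have /choice[c cP] i : exists c : 'I_n -> K,
    (forall j, A (c j)) /\ x * s i = \sum_j c j * s j.
  by have [c Ac e] := xs i; exists c.
pose C : 'M[K]_n := \matrix_(j, i) c i j.
exists (char_poly C); split.
- exact: char_poly_monic.
- by apply: char_poly_over => // i j; rewrite mxE; have [] := cP j.
- rewrite -eigenvalue_root_char; apply/eigenvalueP.
  exists (\row_i s i); last first.
    by apply/eqP => /rowP /(_ i0); rewrite !mxE; apply/eqP.
  apply/rowP => i; rewrite !mxE; have [_ ->] := cP i.
  by apply: eq_bigr => j _; rewrite !mxE mulrC.
Qed.

Lemma span_denominator A n (s : 'I_n -> K) : is_subring A ->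
  has_fraction_field A -> exists d, [/\ A d, d != 0 & forall i, A (d * s i)].
Proof.
move=> Ar Af.
have /choice[b bP] i : exists b, [/\ A b, b != 0 & A (b * s i)].
  have [a [b [Aa Ab b0 sE]]] := Af (s i); exists b; split=> //.
  by rewrite sE mulrC divfK.
exists (\prod_i b i); split.
- elim/big_ind: _ => [|y z|i _]; [exact: ring1|exact: ringM|by have [] := bP i].
- by apply/prodf_neq0 => i _; have [] := bP i.
- move=> i; rewrite (bigD1 i) //= mulrAC; apply: ringM => //.
    by have [] := bP i.
  elim/big_ind: _ => [|y z|j _]; [exact: ring1|exact: ringM|by have [] := bP j].
Qed.

Lemma fg_frac A M : is_subring A -> has_fraction_field A ->
  finitely_generated A M -> (exists2 x, M x & x != 0) -> is_fractional_ideal A M.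
Proof.
move=> Ar Af [n [s ->]] M0; split=> //; first exact: span_submod.
have [d [Ad d0 ds]] := span_denominator s Ar Af; exists d; split=> //.
suff: module_span A s `<=` [set x | A (d * x)] by [].
apply: (@span_min _ A) => //; split=> /= [|x y|a x Aa].
- by rewrite mulr0; apply: ring0.
- by rewrite mulrDr; apply: ringD.
- by rewrite mulrCA; apply: ringM.
Qed.

Lemma noetherian_frac_fg A M : is_subring A -> is_noetherian A ->
  is_fractional_ideal A M -> finitely_generated A M.
Proof.
move=> Ar noeth [Ms _ [d [Ad d0 dM]]].
have [|n [s e]] := noeth (principal M d).
  by split; [apply: submod_scale|move=> _ [x Mx <-]; apply: dM].
exists n, (fun i => d^-1 * s i); rewrite -(scaleK M d0) e.
apply/seteqP; split=> [_ [_ [c Ac ->] <-]|_ [c Ac ->]].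
  by exists c => //; rewrite mulr_sumr; apply: eq_bigr => i _; rewrite mulrCA.
exists (\sum_i c i * s i); first by exists c.
by rewrite mulr_sumr; apply: eq_bigr => i _; rewrite mulrCA.
Qed.

(** Integrality in a form stable under products of fractional ideals, which
    makes the integral elements a ring. *)
Lemma integralP A x : is_subring A -> has_fraction_field A -> is_noetherian A ->
  normalization A x <->
  exists2 M, is_fractional_ideal A M & forall y, M y -> M (x * y).
Proof.
move=> Ar Af noeth; split=> [[q [qm qA qx]]|[M Mf xM]]; last first.
  have [n [s e]] := noetherian_frac_fg Ar noeth Mf.
  apply: (@span_integral _ n s) => //; last first.
    by move=> i; rewrite -e; apply: xM; rewrite e; apply: span_gen.
  apply: contrapT => h; have [_ [y My /eqP y0] _] := Mf; apply: y0.
  have: M `<=` [set 0]; last exact.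
  rewrite e; apply: (@span_min _ A).
    by split=> //= [_ _ -> ->|a _ _ ->]; rewrite ?addr0 ?mulr0.
  by move=> i /=; apply/eqP; apply: contrapT => /negP si; apply: h; exists i.
(* M is spanned by the powers of x below the degree of its equation q *)
pose n := (size q).-1; pose s (i : 'I_n) := x ^+ i.
have szq : size q = n.+1 by rewrite prednK // size_poly_gt0 monic_neq0.
have xn : x ^+ n = - \sum_(i < n) q`_i * x ^+ i.
  move/rootP: qx; rewrite horner_coef szq big_ord_recr /= => /eqP.
  by rewrite addrC addr_eq0 -[q`_n]/(lead_coef q) (monicP qm) mul1r => /eqP.
have n0 : (0 < n)%N.
  rewrite lt0n; apply/eqP => n0; move: xn; rewrite n0 big_ord0 expr0 oppr0.
  by apply/eqP; rewrite oner_eq0.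
have Ss := span_submod s Ar; have s1 : module_span A s 1 by apply: (span_gen s (Ordinal n0)).
exists (module_span A s).
  apply: fg_frac => //; first by exists n, s.
  by exists 1; rewrite ?oner_neq0.
suff: module_span A s `<=` [set y | module_span A s (x * y)] by [].
apply: (@span_min _ A) => /=.
  split=> /= [|y z|a y Aa]; first by rewrite mulr0; apply: submod0 Ss.
    by rewrite mulrDr; apply: (submodD Ss).
  by rewrite mulrCA; apply: (submodM Ss).
move=> i; rewrite /s -exprS; case: (ltnP i.+1 n) => ni.
  exact: (span_gen s (Ordinal ni)).
have -> : i.+1 = n by apply/eqP; rewrite eqn_leq ltn_ord.
rewrite xn; apply: (submodN Ar Ss); exists (fun i : 'I_n => q`_i) => //.
by move=> j; apply: polyOver_coef.
Qed.

Section Normalization.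
Variable A : set K.
Hypotheses (Ar : is_subring A) (Af : has_fraction_field A) (noeth : is_noetherian A).
Let B := normalization A.

Lemma normalization_sub : A `<=` B.
Proof.
move=> x Ax; apply/integralP => //; exists A; first exact: frac_ring.
by move=> y; apply: ringM.
Qed.

Lemma normalization_ring : is_subring B.
Proof.
split; first by rewrite inE; apply: normalization_sub; apply: ring1.
  move=> x y; rewrite !inE => /(integralP _ Ar Af noeth)[M Mf xM].
  move=> /(integralP _ Ar Af noeth)[N Nf yN].
  apply/integralP => //; exists (mulm M N); first exact: frac_mul.
  have MNs := submod_mulm N (frac_submod Mf).
  suff: mulm M N `<=` [set z | mulm M N ((x - y) * z)] by [].
  apply: mulm_min => /= [|u v|u v Mu Nv]; first by rewrite mulr0; apply: mulm0.
    by rewrite mulrDr; apply: mulmD.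
  rewrite mulrBl; apply: (submodB Ar MNs).
    by rewrite mulrA; apply: mem_mulm => //; apply: xM.
  by rewrite mulrCA; apply: mem_mulm => //; apply: yN.
move=> x y; rewrite !inE => /(integralP _ Ar Af noeth)[M Mf xM].
move=> /(integralP _ Ar Af noeth)[N Nf yN].
apply/integralP => //; exists (mulm M N); first exact: frac_mul.
suff: mulm M N `<=` [set z | mulm M N (x * y * z)] by [].
apply: mulm_min => /= [|u v|u v Mu Nv]; first by rewrite mulr0; apply: mulm0.
  by rewrite mulrDr; apply: mulmD.
by rewrite mulrACA; apply: mem_mulm; [apply: xM|apply: yN].
Qed.

Lemma normalization_frac : finitely_generated A B -> is_fractional_ideal A B.
Proof.
move=> /fg_frac; apply=> //; exists 1; rewrite ?oner_neq0 //.
exact: normalization_sub (ring1 Ar).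
Qed.

End Normalization.

End Integrality.
(** * Residue degrees *)

Section Residue.
Context {K : fieldType}.
Implicit Types (A B I J L M N P X p q : set K) (x y : K).

(** Removing the first vector of a basis gives a submodule L of M with basis the
    other vectors, and M / L is generated by the removed vector. *)
Lemma basis_comp A P M n (s : 'I_n -> K) : is_subring A ->
  is_submodule A P -> is_submodule A M -> P `<=` M ->
  maximal_ideals A (P `&` A) -> (forall a x, P a -> A a -> M x -> P (a * x)) ->
  residue_basis A M P s -> exists2 t, cseries A P M t & size t = n.
Proof.
move=> Ar Ps + + qm; elim: n M s => [|n ih] M s Ms PM qM [sM gen free].
  have -> : M = P.
    apply/seteqP; split=> // x Mx; have [c _] := gen x Mx.
    by rewrite big_ord0 subr0.
  by exists [::] => //; apply: comp_nil.
pose s' i := s (fintype.lift ord0 i).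
pose L := addm P (module_span A s').
have Ss := span_submod s' Ar; have Ls : is_submodule A L by apply: submod_add.
have PL : P `<=` L by apply: addm_subl Ss.
have s'L i : L (s' i) by apply: (addm_subr Ps); apply: span_gen.
have LM : L `<=` M.
  by apply: (addm_min Ms) => //; apply: (span_min Ms) => i; apply: sM.
have bL : residue_basis A L P s'.
  split=> [//|_ [y Py [_ [c Ac ->] <-]]|c Ac Pc i].
    by exists c; rewrite ?addrK.
  pose d (j : 'I_n.+1) := oapp c 0 (unlift ord0 j).
  have := free d; rewrite big_ord_recl /d unlift_none /= mul0r add0r.
  under eq_bigr do rewrite liftK /=.
  move=> /(_ _ Pc (fintype.lift ord0 i)); rewrite liftK; apply.
  by move=> j; case: unliftP => [k _|_] /=; [apply: Ac|apply: ring0].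
have [|t ct sz] := ih L s' Ls PL _ bL; first by move=> a x Pa Aa /LM; apply: qM.
have nLs : ~ L (s ord0).
  move=> [y Py [_ [c Ac ->] sE]].
  pose d (j : 'I_n.+1) := oapp (fun i => - c i) 1 (unlift ord0 j).
  have := free d; rewrite big_ord_recl /d unlift_none /= mul1r.
  under eq_bigr do rewrite liftK /= mulNr.
  rewrite sumrN -{1}sE addrK => /(_ _ Py ord0); rewrite unlift_none /= => h.
  apply: (maximal_not1 Ar qm); apply: h => j.
  by case: unliftP => [k _|_] /=; [apply: ringN|apply: ring1].
have [|sim _] := simple_addx Ar qm Ls nLs.
  by move=> a [Pa Aa]; apply: PL; apply: qM.
have ME : M = addm L (principal A (s ord0)).
  apply/seteqP; split; last first.
    by apply: (addm_min Ms) => //; apply: (scale_sub Ms).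
  move=> x Mx; have [c Ac] := gen x Mx; rewrite big_ord_recl => Pc.
  exists (x - c ord0 * s ord0); last first.
    by exists (c ord0 * s ord0); [exists (c ord0); rewrite // mulrC|rewrite subrK].
  exists (x - (c ord0 * s ord0 + \sum_(i < n) c (fintype.lift ord0 i) * s' i)) => //.
  exists (\sum_(i < n) c (fintype.lift ord0 i) * s' i).
    by exists (fun i => c (fintype.lift ord0 i)).
  by rewrite opprD addrA subrK.
exists (colon A L M :: t); last by rewrite /= sz.
by rewrite -ME in sim; apply: comp_cons ct sim erefl.
Qed.

(** A basis is obtained by choosing one vector in each step of the series. *)
Lemma comp_basis A P M t : is_subring A -> is_submodule A P ->
  maximal_ideals A (P `&` A) -> (forall a x, P a -> A a -> M x -> P (a * x)) ->
  cseries A P M t -> exists s : 'I_(size t) -> K, residue_basis A M P s.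
Proof.
move=> Ar Ps qm + c; elim: c => [_ _|L {}M q {}t c ih sim _ qM].
  exists (fun=> 0); split=> [i|b Pb|d _ _ []//]; first exact: submod0 Ps.
  by exists (fun=> 0) => [_|]; [apply: ring0|rewrite big_ord0 subr0].
have [Ls Ms [LM _] _] := sim.
have [|s [sL gen free]] := ih; first by move=> a x Pa Aa /LM; apply: qM.
have [x Mx nLx] := simple_elt sim; have PL := comp_sub c.
exists (fun i => oapp s x (unlift ord0 i)).
have sumE (d : 'I_(size t).+1 -> K) : \sum_i d i * oapp s x (unlift ord0 i) =
    d ord0 * x + \sum_i d (fintype.lift ord0 i) * s i.
  rewrite big_ord_recl unlift_none /=; congr (_ + _).
  by apply: eq_bigr => i _; rewrite liftK.
split=> [i|b|d Ad].
- by case: unliftP => [k _|_] //=; apply: LM.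
- rewrite (simple_span Ar sim Mx nLx) => -[l Ll [_ [a Aa <-] <-]].
  have [d Ad Pd] := gen l Ll.
  exists (fun i => oapp d a (unlift ord0 i)).
    by move=> i; case: unliftP => [k _|_] /=.
  rewrite sumE unlift_none /=; under eq_bigr do rewrite liftK /=.
  by rewrite opprD addrA (mulrC a) addrK.
- rewrite sumE => Pd.
  have Ld : L (\sum_i d (fintype.lift ord0 i) * s i).
    by apply: (submod_sum _ Ls) => i _; apply: (submodM Ls).
  have d0 : (P `&` A) (d ord0).
    apply: contrapT => nd; apply: nLx.
    have [u [v [Au [Pv Av] e]]] := maximal_comax Ar qm (Ad ord0) nd.
    rewrite -(mul1r x) -e mulrDl; apply: (submodD Ls); last first.
      by apply: PL; apply: qM.
    rewrite -mulrA; apply: (submodM Ls) => //.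
    rewrite -[_ * x](addrK (\sum_i d (fintype.lift ord0 i) * s i)).
    by apply: (submodB Ar Ls) => //; apply: PL.
  have Pd' : P (\sum_i d (fintype.lift ord0 i) * s i).
    rewrite -[X in P X](addKr (d ord0 * x)) addrC.
    by apply: (submodB Ar Ps) => //; case: d0 => ? ?; apply: qM.
  move=> i; case: (unliftP ord0 i) => [j ->|-> //].
  exact: (free (fun i => d (fintype.lift ord0 i)) _ Pd').
Qed.

End Residue.

(** * Push-forward along a finite extension *)

Section Extension.
Context {K : fieldType}.
Implicit Types (I J L M N P X p q : set K) (x y : K).
Variables A B : set K.
Hypotheses (Afl : finlen_ring A) (Br : is_subring B) (AB : A `<=` B).
Hypothesis Bfrac : is_fractional_ideal A B.
Let Ar : is_subring A. Proof. exact: finlen_subring Afl. Qed.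
Let Af : has_fraction_field A. Proof. by case: Afl. Qed.
Let Bs := submod_ring Br.
Let rs M : is_submodule B M -> is_submodule A M := @submod_restrict K A B M AB.

Lemma frac_restrict M : is_fractional_ideal B M -> is_fractional_ideal A M.
Proof.
move=> [Ms M0 [d [Bd d0 dM]]]; split=> //; first exact: rs.
have [_ _ [e [Ae e0 eB]]] := Bfrac.
exists (e * (e * d)); split.
- by apply: ringM => //; apply: eB.
- by rewrite !mulf_neq0.
- move=> x Mx; rewrite -!mulrA; apply: ringM => //; apply: eB; exact: dM.
Qed.

(** Among the proper B-submodules of M, one for which M / X has the least length over
    A gives a simple quotient over B; the induction goes on with X / N, of smaller
    length over A. *)
Lemma comp_coarsen N M s : is_submodule B N -> is_submodule B M ->
  cseries A N M s -> exists t, cseries B N M t.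
Proof.
elim: {s}(size s).+1 {-2}s (ltnSn (size s)) M => // n ih s sn M Ns Ms c.
case: (pselect (M = N)) => [->|MN]; first by exists [::]; apply: comp_nil.
pose good k := exists X u, [/\ is_submodule B X, N `<=` X, X `<=` M, X <> M &
  cseries A X M u /\ size u = k].
have ex : exists k, `[< good k >].
  exists (size s); apply/asboolP; exists N, s; split=> //; first exact: comp_sub c.
  by move=> e; apply: MN.
case: (ex_minnP ex) => k /asboolP[X [u [Xs NX XM XneqM [cu uk]]]] min.
have sim : simple B X M.
  split=> //; first by split=> // MX; apply: XneqM; apply/seteqP.
  move=> Y Ys XY YM; case: (pselect (Y = M)) => [|YneqM]; [by right|left].
  have [s1 [s2 [c1 c2 pe]]] := comp_split Ar cu (rs Ys) XY YM.
  have : (k <= size s2)%N.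
    apply: min; apply/asboolP; exists Y, s2; split=> //; exact: subset_trans XY.
  rewrite -uk (perm_size pe) size_cat -[X in (_ <= X)%N]add0n leq_add2r leqn0.
  by move=> /nilP s10; move: c1; rewrite s10 => /comp_nilP.
have [s1 [s2 [c1 c2 pe]]] := comp_split Ar c (rs Xs) NX XM.
have s1n : (size s1 < n)%N.
  apply: leq_trans (_ : size s <= n)%N; last by rewrite -ltnS.
  rewrite (perm_size pe) size_cat -[X in (X < _)%N]addn0 ltn_add2l lt0n.
  by apply/eqP => /size0nil s20; apply: XneqM; move: c2; rewrite s20 => /comp_nilP ->.
have [t ct] := ih s1 s1n X Ns Xs c1.
by exists (colon B X M :: t); apply: comp_cons ct sim erefl.
Qed.

Lemma extension_finlen : finlen_ring B.
Proof.
split=> //.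
  by move=> x; have [a [b [Aa Ab b0 ->]]] := Af x; exists a, b; split=> //; apply: AB.
move=> I [Is IB] I0; have If : is_fractional_ideal A I.
  have [_ _ [d [Ad d0 dB]]] := Bfrac; split=> //; first exact: rs.
  by exists d; split=> // x /IB; apply: dB.
have [s c] := finlen_comp Afl If Bfrac IB.
exact: comp_coarsen c.
Qed.

(** As a module over A, a simple quotient B / P is a vector space over the field
    A / (P ∩ A), so its length over A is the residue degree. *)
Lemma residue_comp P : maximal_ideals B P -> is_fractional_ideal B P ->
  maximal_ideals A (P `&` A) /\
  cseries A P B (nseq (residue_degree A B P) (P `&` A)).
Proof.
move=> Pm Pf; have Ps := maximal_submod Pm; have PB := maximal_sub Pm.
have [t c] := finlen_comp Afl (frac_restrict Pf) Bfrac PB.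
have Pq q : q \in t -> P `&` A `<=` q.
  move=> qt a [Pa Aa]; apply: (comp_colon Ar c qt); split=> // x Bx.
  by rewrite mulrC; apply: (submodM Ps).
have qm : maximal_ideals A (P `&` A).
  case: t c Pq => [/comp_nilP e|q t c Pq].
    by have [_ /eqP] := Pm; rewrite e.
  have [L [cL sim qE]] := comp_consP c; have PL := comp_sub cL.
  have [Ls _ [LB nBL] _] := sim; have qm := colon_maximal Ar sim.
  rewrite -qE in qm.
  have <- // : q = P `&` A.
  apply/seteqP; split; last by apply: Pq; apply: mem_head.
  move=> a qa; have Aa := maximal_sub qm qa; split=> //; apply: contrapT => nPa.
  have [b [d [Bb Pd e]]] := maximal_comax Br Pm (AB Aa) nPa.
  apply: nBL => x Bx; rewrite -(mul1r x) -e mulrDl; apply: (submodD Ls); last first.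
    by apply: PL; rewrite mulrC; apply: (submodM Ps).
  move: qa; rewrite qE => -[_ h]; rewrite mulrAC mulrC; apply: h; exact: ringM.
split=> //; have tE : t = nseq (size t) (P `&` A).
  apply/all_pred1P/allP => q qt /=; apply/eqP/esym.
  exact: (maximal_eq Ar qm (comp_maximal Ar c qt) (Pq q qt)).
have qB a x : P a -> A a -> B x -> P (a * x).
  by move=> Pa _ Bx; rewrite mulrC; apply: (submodM Ps).
suff -> : residue_degree A B P = size t by rewrite -tE.
rewrite /residue_degree; apply: xget_unique => [|n [s sb]].
  exact: comp_basis (rs Ps) qm qB c.
have [t' c' <-] := basis_comp Ar (rs Ps) (rs Bs) PB qm qB sb.
exact: perm_size (comp_uniq Ar c' c).
Qed.

(** For x in M but not in L, multiplication by x identifies B / P with M / L. *)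
Lemma simple_residue_comp L M : simple B L M ->
  is_fractional_ideal B (colon B L M) -> let P := colon B L M in
  cseries A L M (nseq (residue_degree A B P) (P `&` A)).
Proof.
move=> sim Pf P; have Pm := colon_maximal Br sim.
have [_ c] := residue_comp Pm Pf; have [x Mx nLx] := simple_elt sim.
have [Ls Ms _ _] := sim.
have x0 : x != 0 by apply/eqP => x0; apply: nLx; rewrite x0; apply: submod0 Ls.
have := comp_scale Ar x0 c.
have -> : principal P x = principal B x `&` L.
  apply/seteqP; split=> [_ [b [Bb bM] <-]|_ [[b Bb <-] Lxb]].
    by split; [exists b|rewrite mulrC; apply: bM].
  by exists b => //; apply: (colon_span Br sim Mx nLx); rewrite // mulrC.
move=> /(comp_quotient Ar (rs Ls))[t].
rewrite addmC -(simple_span Br sim Mx nLx) => ct pe.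
have tE : t = nseq (residue_degree A B P) (P `&` A).
  have <- : size t = residue_degree A B P by rewrite -(perm_size pe) size_nseq.
  by apply/all_pred1P; rewrite -(perm_all _ pe) all_nseq /= eqxx orbT.
by rewrite -tE.
Qed.

Definition push_prime P : {freeg (set K) / int} :=
  << (residue_degree A B P)%:Z *g P `&` A >>.

(** The push-forward is the linear extension of its values on primes, hence
    additive. *)
Lemma push_forwardE D : push_forward A B D = fglift push_prime D.
Proof.
rewrite -{2}(freeg_sumE D).
have addL := lift_is_additive push_prime.
pose f : {additive {freeg (set K) / int} -> {freeg (set K) / int}} :=
  HB.pack (fglift push_prime) (GRing.isZmodMorphism.Build _ _ _ addL).
rewrite -[fglift _ _]/(f _) raddf_sum /=; apply: eq_bigr => P _.
rewrite liftU; apply/eqP/freeg_eqP => q.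
by rewrite coeffZ !coeffU mulrA.
Qed.

Lemma push_forwardB D E :
  push_forward A B (D - E) = push_forward A B D - push_forward A B E.
Proof. by rewrite !push_forwardE lift_is_additive. Qed.

Lemma push_forward0 : push_forward A B 0 = 0.
Proof. by have := push_forwardB 0 0; rewrite !subrr. Qed.

Lemma push_forwardD D E :
  push_forward A B (D + E) = push_forward A B D + push_forward A B E.
Proof.
have := push_forwardB D (- E); rewrite opprK => ->; congr (_ + _).
by have := push_forwardB 0 E; rewrite !sub0r push_forward0 sub0r => ->; rewrite opprK.
Qed.

Lemma push_forward1 P : push_forward A B << P >> = push_prime P.
Proof. by rewrite push_forwardE liftU scale1r. Qed.

Hypothesis maxfrac : forall P, maximal_ideals B P -> is_fractional_ideal B P.

Lemma sum_nseq n p : \sum_(q <- nseq n p) << q >> = << n%:Z *g p >> :> {freeg (set K) / int}.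
Proof.
elim: n => [|n ih]; first by rewrite big_nil freegU0.
by rewrite big_cons ih freegUD intS.
Qed.

(** Refining every simple step over B to a series over A replaces the annihilator P
    by copies of its contraction, as many as the residue degree. *)
Lemma push_comp N M s : cseries B N M s -> exists2 t, cseries A N M t &
  \sum_(q <- t) << q >> = push_forward A B (\sum_(P <- s) << P >>).
Proof.
elim=> [Ns|L {}M P {}s c [t ct tE] sim PE].
  by exists [::]; [apply: comp_nil; apply: rs|rewrite !big_nil push_forward0].
have Pf : is_fractional_ideal B P by apply: maxfrac; rewrite PE; apply: colon_maximal.
have := simple_residue_comp sim; rewrite -PE => /(_ Pf) c'.
exists (nseq (residue_degree A B P) (P `&` A) ++ t); first exact: comp_cat c'.
rewrite big_cat big_cons push_forwardD push_forward1 tE; congr (_ + _).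
exact: sum_nseq.
Qed.

Lemma push_cyc N M : is_fractional_ideal B N -> is_fractional_ideal B M ->
  N `<=` M -> cyc A N M = push_forward A B (cyc B N M).
Proof.
move=> Nf Mf NM; have [s c] := finlen_comp extension_finlen Nf Mf NM.
by have [t ct tE] := push_comp c; rewrite (cycE Ar ct) (cycE Br c).
Qed.

Lemma push_idx N M : is_fractional_ideal B N -> is_fractional_ideal B M ->
  idx A N M = push_forward A B (idx B N M).
Proof.
move=> Nf Mf; have [_ Bf _] := extension_finlen.
have If := frac_setI Br Bf Nf Mf.
rewrite /idx push_forwardB (push_cyc If Nf (@subIsetl _ _ _)).
by rewrite (push_cyc If Mf (@subIsetr _ _ _)).
Qed.

Lemma inverse_extend M M' :
  inverse_of A M M' -> inverse_of B (mulm M B) (mulm M' B).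
Proof.
move=> [Ms Ms' e]; split; try exact: submod_mulmr.
by rewrite mulmA -(mulmA M) (mulmC B) mulmA e !mulm_ring //; apply: rs.
Qed.

(** The projection formula: as M is invertible, its index in A equals the index
    of M B in B. *)
Lemma push_chi M M' : inverse_of A M M' ->
  chi A M = push_forward A B (chi B (mulm M B)).
Proof.
move=> h; have Mf := inverse_frac Ar Af h; have Afrac := frac_ring Ar.
have [_ Bf _] := extension_finlen.
have MBf : is_fractional_ideal A (mulm M B) by apply: frac_mul.
have e : idx A M (mulm M B) = idx A A B.
  by rewrite -{1}(mulm_ringr Ar (frac_submod Mf)) (idx_mul Afl h).
have := idx_trans Afl Afrac Mf MBf; rewrite -(idx_trans Afl Afrac Bfrac MBf) e addrC.
move=> /addrI; rewrite /chi => ->; apply: push_idx; first exact: frac_ring.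
exact: inverse_frac (inverse_extend h).
Qed.

End Extension.
(** * Invertible ideals *)

Section Dedekind.
Context {K : fieldType}.
Implicit Types (A B I J L M N P X p q f : set K) (x y : K).

(** Q is the annihilator of the top simple quotient of A / I. *)
Lemma finlen_proper A I : finlen_ring A -> is_ideal A I ->
  (exists2 x, I x & x != 0) -> ~ I 1 -> exists2 Q, maximal_ideals A Q & I `<=` Q.
Proof.
move=> [Ar Af fl] Ii I0 nI1; have [[|q s] c] := fl I Ii I0.
  by case: nI1; rewrite -(comp_nilP c); apply: ring1.
have [L [cL sim qE]] := comp_consP c; exists (colon A L A); first exact: colon_maximal.
move=> x Ix; have [_ IA] := Ii; have [Ls _ _ _] := sim; split; first exact: IA.
by move=> y Ay; rewrite mulrC; apply: (submodM Ls) => //; apply: (comp_sub cL).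
Qed.

(** The factor of the divisor of a at a single maximal ideal p comes from an
    invertible ideal, namely aA + p^n with n the multiplicity of p in A / aA: it is
    comaximal with aA + Y, where Y is the product of the other factors, and their
    product is aA. *)
Lemma chi_primary A p a : finlen_ring A -> maximal_ideals A p -> A a -> a != 0 ->
  exists2 M, invertible_ideals A M &
    chi A M = << coeff p (chi A (principal A a)) *g p >>.
Proof.
move=> Afl pm Aa a0; have [Ar Af _] := Afl.
have As := submod_ring Ar; have aAf := principal_frac Afl a0.
have aAs := frac_submod aAf; have aA : principal A a `<=` A by apply: (scale_sub As).
have Afrac := frac_ring Ar; have [s c] := finlen_comp Afl aAf Afrac aA.
(* X is a power of p, and Y the product of the other factors of A / aA *)
pose t := [seq q <- s | q == p]; pose u := [seq q <- s | q != p].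
have sm q : q \in s -> maximal_ideals A q by apply: comp_maximal c.
have tm q : q \in t -> maximal_ideals A q by rewrite mem_filter => /andP[_ /sm].
have um q : q \in u -> maximal_ideals A q by rewrite mem_filter => /andP[_ /sm].
have sub v : (forall q, q \in v -> maximal_ideals A q) -> prodm A v `<=` A.
  by move=> vm; apply: (prodm_sub Ar As) => q /vm; apply: maximal_sub.
pose X := prodm A t; pose Y := prodm A u.
have XA : X `<=` A by apply: sub.
have YA : Y `<=` A by apply: sub.
have Xs : is_submodule A X by apply: submod_prodm.
have Ys : is_submodule A Y by apply: submod_prodm.
have XY x y : X x -> Y y -> principal A a (x * y).
  move=> Xx Yy; apply: (comp_prodm Ar c).
  rewrite -(@prodm_perm _ A (t ++ u)) ?perm_filterC // prodm_cat -(prodm_ring t Ar Ys).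
  exact: mem_mulm.
pose M := addm (principal A a) X; pose N := addm (principal A a) Y.
have Ms : is_submodule A M by apply: submod_add.
have Ns : is_submodule A N by apply: submod_add.
have MA : M `<=` A by apply: (addm_min As).
have NA : N `<=` A by apply: (addm_min As).
have XM : X `<=` M by apply: addm_subr aAs.
have YN : Y `<=` N by apply: addm_subr aAs.
have Ma : M a by apply: (addm_subl Xs); apply: mem_scale.
have Na : N a by apply: (addm_subl Ys); apply: mem_scale.
have fracI Z : is_submodule A Z -> Z `<=` A -> Z a -> is_fractional_ideal A Z.
  move=> Zs ZA Za; split=> //; first by exists a.
  exists 1; split; [exact: ring1|exact: oner_neq0|].
  by move=> z /ZA; rewrite mul1r.
have MNs : is_submodule A (addm M N) by apply: submod_add.
have [m Mm [n Nn mn1]] : addm M N 1.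
  apply: contrapT => n1; have [||Q Qm MNQ] := finlen_proper Afl _ _ n1.
  - by split=> //; apply: (addm_min As).
  - by exists a => //; apply: (addm_subl Ns).
  have : Q \in t.
    apply: (maximal_prodm Ar Qm tm); apply: subset_trans MNQ.
    exact: subset_trans XM (addm_subl Ns).
  have : Q \in u.
    apply: (maximal_prodm Ar Qm um); apply: subset_trans MNQ.
    exact: subset_trans YN (addm_subr Ms).
  by rewrite !mem_filter => /andP[/negbTE ->].
have MN : mulm M N = principal A a.
  apply/seteqP; split.
    apply: (mulm_subset aAs) => _ _ [_ [i Ai <-] [x Xx <-]] [_ [j Aj <-] [y Yy <-]].
    have aA' b : A b -> principal A a (a * b) by exists b.
    rewrite mulrDl -mulrA; apply: (submodD aAs).
      apply/aA'; apply: ringM => //; apply: NA; exists (a * j); first exact: (aA' _ Aj).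
      by exists y.
    rewrite mulrDr; apply: (submodD aAs); last exact: XY.
    by rewrite mulrCA; apply/aA'; apply: ringM => //; apply: XA.
  apply: scale_sub; first exact: submod_mulm.
  rewrite -(mulr1 a) -mn1 mulrDr; apply: mulmD; last exact: mem_mulm.
  by rewrite mulrC; apply: mem_mulm.
have h : inverse_of A M (principal N a^-1).
  by split=> //; [apply: submod_scale|rewrite mulm_scaler MN scaleK].
have chiS Z v q : is_fractional_ideal A Z -> Z `<=` A ->
    (forall r, r \in v -> maximal_ideals A r) -> prodm A v `<=` Z ->
    q \notin v -> coeff q (chi A Z) = 0.
  move=> Zf ZA vm vZ qv; rewrite (chi_ideal Afl Zf ZA).
  have [w cw] := finlen_comp Afl Zf Afrac ZA; rewrite (coeff_cyc q Ar cw).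
  case: (boolP (q \in w)) => [qw|/count_memPn -> //].
  case/negP: qv; apply: (maximal_prodm Ar (comp_maximal Ar cw qw) vm).
  apply: subset_trans vZ _ => z Zz; apply: (comp_colon Ar cw qw).
  split; first exact: ZA.
  by move=> y Ay; rewrite mulrC; apply: (submodM (frac_submod Zf)).
have Mf := fracI M Ms MA Ma; have Nf := fracI N Ns NA Na.
exists M; first by apply/invertibleP => //; eexists; exact: h.
have e := chi_mul Afl h Nf; rewrite MN in e.
apply/eqP/freeg_eqP => q; rewrite coeffU; case: eqP => [<-|pq].
  rewrite mulr1 e coeffD (chiS N u p) ?addr0 //.
  by rewrite mem_filter eqxx.
rewrite mulr0; apply: (chiS M t) => //.
by rewrite mem_filter; apply/negP => /andP[/eqP/esym].
Qed.

(** The ideals of A with a given extension to B are found from a common ideal f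
    of A and B: if y and z generate J and its inverse modulo f, then
    yA + fJ and zA + fJ' are mutually inverse over A. *)
Lemma inverse_descend A B f J J' y z : is_subring A -> is_subring B -> A `<=` B ->
  is_ideal B f -> f `<=` A -> inverse_of B J J' -> J y -> J' z -> f (1 - y * z) ->
  exists M N, inverse_of A M N /\ mulm M B = J.
Proof.
move=> Ar Br AB [fs fB] fA h Jy Jz fyz; have [Js Js' JJ] := h.
have rs M : is_submodule B M -> is_submodule A M := submod_restrict AB (M := M).
have As := submod_ring Ar; have Bs := submod_ring Br.
have JJ' u v : J u -> J' v -> B (u * v) by move=> Ju Jv; rewrite -JJ; apply: mem_mulm.
have fJs : is_submodule B (mulm f J) by apply: submod_mulm.
have fJs' : is_submodule B (mulm f J') by apply: submod_mulm.
have fJJ := mulm_idl Js fB.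
have fu u v : mulm f J u -> J' v -> f (u * v).
  by move=> fu Jv; rewrite -(mulm_ringr Br fs) -JJ mulmA; apply: mem_mulm.
have fv u v : J u -> mulm f J' v -> f (u * v).
  move=> Ju fv; rewrite -(mulm_ring Br fs) -JJ -mulmA (mulmC J') ; exact: mem_mulm.
pose M := addm (principal A y) (mulm f J); pose N := addm (principal A z) (mulm f J').
have ys := submod_scale y As; have zs := submod_scale z As.
have Ms : is_submodule A M by apply: submod_add => //; apply: rs.
have Ns : is_submodule A N by apply: submod_add => //; apply: rs.
have My : M y by apply: (addm_subl (rs _ fJs)); apply: mem_scale.
have Nz : N z by apply: (addm_subl (rs _ fJs')); apply: mem_scale.
have fM : mulm f J `<=` M by apply: addm_subr ys.
have fN : mulm f J' `<=` N by apply: addm_subr zs.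
have Ayz : A (y * z).
  rewrite -(subKr 1 (y * z)) ; apply: ringB => //; [exact: ring1|exact: fA].
have MJ : M `<=` J.
  by apply: (addm_min Js) => // _ [a Aa <-]; rewrite mulrC; apply: (submodM Js) => //; apply: AB.
have MNs : is_submodule A (mulm M N) by apply: submod_mulm.
have fMN : f `<=` mulm M N.
  rewrite -{1}(mulm_ringr Br fs) -JJ mulmA.
  apply: (mulm_subset MNs) => u w fJu Jw.
  (* w = (y w) z + (1 - y z) w, whence J' = z B + f J' *)
  have -> : u * w = (y * w) * u * z + u * ((1 - y * z) * w) by ring.
  apply: (submodD MNs); apply: mem_mulm => //; last by apply: fN; apply: mem_mulm.
    by apply: fM; apply: (submodM fJs) => //; apply: JJ'.
  exact: fM.
exists M, N; split.
  split=> //; apply/seteqP; split.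
    apply: (mulm_subset As) => u _ Mu [_ [b Ab <-] [v fJv <-]].
    rewrite mulrDr; apply: ringD => //; last by apply: fA; apply: fv => //; apply: MJ.
    rewrite mulrA; apply: ringM => //; move: Mu => [_ [a Aa <-] [w fJw <-]].
    rewrite mulrDl; apply: ringD => //; last by apply: fA; apply: fu.
    by rewrite mulrAC; apply: ringM.
  move=> a Aa; rewrite -(mulr1 a); apply: (submodM MNs) => //.
  rewrite -(subrK (y * z) 1); apply: (submodD MNs); first exact: fMN.
  exact: mem_mulm.
apply/seteqP; split.
  by apply: (mulm_subset Js) => u b /MJ Ju Bb; rewrite mulrC; apply: (submodM Js).
(* j = y (j z) + (1 - y z) j, whence J = y B + f J *)
move=> j Jj; have -> : j = y * (j * z) + (1 - y * z) * j * 1 by ring.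
apply: mulmD; first by apply: mem_mulm => //; apply: JJ'.
apply: mem_mulm; last exact: ring1.
by apply: fM; apply: mem_mulm.
Qed.

Section Generators.
Variable B : set K.
Hypothesis Bfl : finlen_ring B.
Let Br : is_subring B. Proof. exact: finlen_subring Bfl. Qed.
Let Bs := submod_ring Br.

(** Induction on the list.  If y fails at a new prime P, it is corrected by an
    element of the product of the earlier primes and J that is not in P J; this
    changes nothing at the earlier primes. *)
Lemma avoid_primes J J' s : inverse_of B J J' -> uniq s ->
  (forall P, P \in s -> maximal_ideals B P) ->
  exists2 y, J y & forall P, P \in s -> ~ mulm P J y.
Proof.
move=> h; have [Js Js' JJ] := h; elim: s => [|P s ih] /=.
  by exists 0 => //; apply: submod0 Js.
move=> /andP[Ps us] sm.
have sm' Q : Q \in s -> maximal_ideals B Q by move=> Qs; apply: sm; rewrite inE Qs orbT.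
have Pm := sm P (mem_head _ _).
have [y Jy yP] := ih us sm'.
case: (pselect (mulm P J y)) => Py; last first.
  by exists y => // Q; rewrite inE => /predU1P[-> //|/yP].
have [w sw Pw] : exists2 w, prodm J s w & ~ mulm P J w.
  apply: contrapT => no; case/negP: Ps; apply: (maximal_prodm Br Pm sm').
  have: prodm J s `<=` mulm P J.
    by move=> w sw; apply: contrapT => Pw; apply: no; exists w.
  move=> /(mulmS (@subset_refl _ J')).
  rewrite -prodm_mulm (mulmC _ J) JJ mulmCA (mulmC J') JJ mulm_ringr //.
  exact: maximal_submod Pm.
have Jw : J w.
  by apply: (prodm_sub Br Js _ sw) => Q /sm'; apply: maximal_sub.
exists (y + w); first exact: (submodD Js).
have QJs Q : is_submodule B (mulm Q J) by apply: submod_mulmr.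
move=> Q; rewrite inE => /predU1P[->|Qs] Qyw.
  by apply: Pw; rewrite -(addKr y w) addrC; apply: (submodB Br (QJs P)).
apply: (yP Q Qs); rewrite -(addrK w y); apply: (submodB Br (QJs Q)) => //.
move: sw; rewrite (prodm_perm J (perm_to_rem Qs)) /=; apply: mulmS => //.
apply: (prodm_sub Br Js) => R /mem_rem /sm'; exact: maximal_sub.
Qed.

(** If y generates J locally at the primes containing f, then y J' + f lies in no
    maximal ideal. *)
Lemma comaximal_generators J J' f : inverse_of B J J' -> is_ideal B f ->
  (exists2 x, f x & x != 0) -> exists y z, [/\ J y, J' z & f (1 - y * z)].
Proof.
move=> h fi [x fx x0]; have [Js Js' JJ] := h; have [fs fB] := fi.
have [_ _ fl] := Bfl; have [|s c] := fl f fi; first by exists x.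
have sm P : P \in undup s -> maximal_ideals B P.
  by rewrite mem_undup; apply: comp_maximal c.
have [y Jy yP] := avoid_primes h (undup_uniq s) sm.
pose X := addm (principal J' y) f.
have yJs := submod_scale y Js'; have Xs : is_submodule B X by apply: submod_add.
have XB : X `<=` B.
  by apply: (addm_min Bs) => // _ [z Jz <-]; rewrite -JJ; apply: mem_mulm.
have fX : f `<=` X by apply: addm_subr yJs.
have [_ [z Jz <-] [b fb e]] : X 1.
  apply: contrapT => n1; have [|Q Qm XQ] := finlen_proper Bfl (conj Xs XB) _ n1.
    by exists x => //; apply: fX.
  have Qs : Q \in undup s.
    rewrite mem_undup; apply: (maximal_prodm Br Qm (fun P => comp_maximal Br c (q := P))).
    apply: subset_trans (comp_prodm Br c) _; exact: subset_trans XQ.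
  apply: (yP Q Qs).
  have: principal (mulm J' J) y `<=` mulm Q J.
    rewrite -mulm_scalel; apply: mulmS => //; apply: subset_trans XQ.
    exact: addm_subl fs.
  by apply; rewrite mulmC JJ; apply: mem_scale.
by exists y, z; split=> //; rewrite -e addrC addKr.
Qed.

End Generators.

Section InvertiblePrimes.
Variable B : set K.
Hypothesis Bfl : finlen_ring B.
Hypothesis primes_inv : forall P, maximal_ideals B P -> exists Q, inverse_of B P Q.
Let Br : is_subring B. Proof. exact: finlen_subring Bfl. Qed.
Let Bf : has_fraction_field B. Proof. by case: Bfl. Qed.
Let Bs := submod_ring Br.
Let Bfrac := frac_ring Br.

Lemma maximal_frac P : maximal_ideals B P -> is_fractional_ideal B P.
Proof. by move=> /primes_inv[Q h]; apply: inverse_frac h. Qed.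

(** Going down a simple step with annihilator P is multiplying by P, since P M
    also has simple quotient in M. *)
Lemma comp_prodm_eq L M M' s :
  inverse_of B M M' -> cseries B L M s -> L = prodm M s.
Proof.
move=> + c; elim: c M' => // X {}M P {}s c ih sim PE M' h.
have Pm : maximal_ideals B P by rewrite PE; apply: colon_maximal.
have [Q hP] := primes_inv Pm; have [Xs Ms [XM nMX] _] := sim.
have [simP _] := maximal_simple Br Pm.
have [simM _] := simple_mul Br h simP.
rewrite (mulm_ringr Br Ms) mulmC in simM.
have [_ _ _ mid] := simM.
have PX : mulm P M `<=` X.
  by apply: (mulm_subset Xs) => a x; rewrite PE => -[_]; apply.
have XE : X = mulm P M.
  case: (mid X Xs PX XM) => // e; case: nMX; rewrite e; exact: subset_refl.
rewrite /= -prodm_mulm -XE; apply: (ih (mulm Q M')).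
by rewrite XE; apply: inverse_mul.
Qed.

(** The intersection of B and M is the product of the same primes in B and in M, up
    to order, and this product can be cancelled. *)
Lemma chi_eq0 M M' : inverse_of B M M' -> chi B M = 0 -> M = B.
Proof.
move=> h; have Mf := inverse_frac Br Bf h; have Lf := frac_setI Br Bf Bfrac Mf.
have [s c] := finlen_comp Bfl Lf Bfrac (@subIsetl _ _ _).
have [t c'] := finlen_comp Bfl Lf Mf (@subIsetr _ _ _).
move=> /eqP; rewrite subr_eq0 => /eqP e.
have pe : perm_eq s t.
  apply/allP => q _ /=; rewrite -eqz_nat -(coeff_cyc q Br c) -(coeff_cyc q Br c').
  by rewrite e.
have hB : inverse_of B B B by split=> //; apply: mulm_ring.
have := comp_prodm_eq h c'; rewrite (comp_prodm_eq hB c) (prodm_perm _ pe).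
have [_ _ e1] := h; rewrite -(prodm_ring t Br (frac_submod Mf)).
have sm : forall q, q \in t -> exists Q, inverse_of B q Q.
  by move=> q /(comp_maximal Br c') /primes_inv.
have [T hT] : exists T, inverse_of B (prodm B t) T.
  elim: (t) sm => [|q v ih] sm; first by exists B.
  have [Q hQ] := sm q (mem_head _ _).
  have [T hT] := ih (fun r rv => sm r (mem_behead (s := q :: v) rv)).
  by exists (mulm Q T); apply: inverse_mul.
move=> /(congr1 (mulm T)); rewrite (inverseK Br hT (frac_submod Mf)) => <-.
by rewrite mulmC; case: hT.
Qed.

Lemma chi_maximal P : maximal_ideals B P -> chi B P = << P >>.
Proof.
move=> Pm; have [sim e] := maximal_simple Br Pm.
rewrite (chi_ideal Bfl (maximal_frac Pm) (maximal_sub Pm)).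
by rewrite (cycE Br (comp_single sim)) big_seq1 e.
Qed.

Lemma dedekind_chi_surj D : Div B D -> exists2 M, invertible_ideals B M & chi B M = D.
Proof.
apply: chi_surj => // P Pm; exists P; last exact: chi_maximal.
by apply/invertibleP => //; apply: primes_inv.
Qed.

End InvertiblePrimes.

(** * The normalization is a Dedekind domain *)

Section NormalizationDedekind.
Variable A : set K.
Hypotheses (Ar : is_subring A) (Af : has_fraction_field A).
Hypotheses (noeth : is_noetherian A) (dim1 : has_krull_dim A 1).
Hypothesis fg : finitely_generated A (normalization A).
Let B := normalization A.
Let Afl := noetherian_dim1_finlen Ar Af noeth dim1.
Let Br : is_subring B := normalization_ring Ar Af noeth.
Let AB : A `<=` B := normalization_sub Ar Af noeth.
Let Bfrac : is_fractional_ideal A B := normalization_frac Ar Af noeth fg.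
Let Bfl : finlen_ring B := extension_finlen Afl Br AB Bfrac.
Let Bs := submod_ring Br.

(** A field has a single prime ideal, so no prime chain of length one. *)
Lemma dim1_proper : A <> setT.
Proof.
move=> e; have [[c [cp cl]] _] := dim1; have [[c1s _] /eqP c1A _] := cp 1%N (leqnn _).
have [_ nc] := cl 0%N (ltnSn _); apply: c1A; apply/seteqP; split; first by rewrite e.
have [[c0s _] _ _] := cp 0%N (leq0n _).
have [x c1x x0] : exists2 x, c 1%N x & x != 0.
  apply: contrapT => h; apply: nc => x c1x.
  have [->|x0] := eqVneq x 0; [exact: submod0 c0s|by case: h; exists x].
move=> a Aa; rewrite -(divfK x0 a); apply: (submodM c1s) => //.
by rewrite e.
Qed.

Lemma normalization_proper : B <> setT.
Proof.
move=> e; apply: dim1_proper; apply/seteqP; split=> // x _.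
have [_ _ [d [Ad d0 dB]]] := Bfrac; rewrite -(divfK d0 x) mulrC.
by apply: dB; rewrite e.
Qed.

Lemma normalization_maximal_neq0 P :
  maximal_ideals B P -> exists2 a, P a & a != 0.
Proof.
move=> Pm; apply: contrapT => P0; apply: normalization_proper; apply/seteqP; split=> // x _.
have z c : P c -> c = 0.
  by move=> Pc; apply/eqP; apply: contrapT => /negP c0; apply: P0; exists c.
have [a [b [Aa Ab b0 ->]]] := Af x.
have [|u [c [Bu Pc e]]] := maximal_comax Br Pm (AB Ab).
  by move=> /z b00; rewrite b00 eqxx in b0.
apply: ringM => //; first exact: AB.
rewrite (z _ Pc) addr0 in e.
by rewrite -(mul1r b^-1) -e mulfK.
Qed.

(** Let 0 <> a in P, and take a shortest product P1 ... Pn of maximal ideals inside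
    aB; P is one of the factors, and y in the product of the others but not in aB
    gives x = y / a outside B with x P inside B.  If P were not invertible then
    x P would be inside P, so that x would be integral. *)
Lemma normalization_primes_inv P :
  maximal_ideals B P -> exists Q, inverse_of B P Q.
Proof.
move=> Pm; have Ps := maximal_submod Pm; have PB := maximal_sub Pm.
have [a Pa a0] := normalization_maximal_neq0 Pm.
have Ba := PB _ Pa; have aBs := submod_scale a Bs.
have [s c] := finlen_comp Bfl (principal_frac Bfl a0) (frac_ring Br) (scale_sub Bs Ba).
pose good n := exists s, [/\ forall P, P \in s -> maximal_ideals B P,
  prodm B s `<=` principal B a & size s = n].
have ex : exists n, `[< good n >].
  exists (size s); apply/asboolP; exists s; split=> //; last exact: comp_prodm c.
  by move=> Q; apply: comp_maximal c.
case: (ex_minnP ex) => n /asboolP[{c}s [sm sa sn]] min.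
have PS : P \in s.
  by apply: (maximal_prodm Br Pm sm); apply: subset_trans (scale_sub Ps Pa).
pose s' := rem P s; have [y s'y nay] : exists2 y, prodm B s' y & ~ principal B a y.
  apply: contrapT => h; have /min : `[< good (size s') >].
    apply/asboolP; exists s'; split=> // [Q /mem_rem /sm //|y s'y].
    by apply: contrapT => nay; apply: h; exists y.
  rewrite size_rem // -sn leqNgt prednK ?leqnn //.
  by case: (s) PS.
have yP b : P b -> principal B a (b * y).
  move=> Pb; apply: sa; rewrite (prodm_perm B (perm_to_rem PS)) /=.
  exact: mem_mulm.
pose x := y / a.
have nBx : ~ B x.
  by move=> Bx; apply: nay; exists x => //; rewrite mulrC divfK.
have xP b : P b -> B (x * b).
  move=> /yP[d Bd e]; rewrite /x mulrAC (mulrC y) -e mulrC.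
  by rewrite mulKf.
pose Q := [set z | forall b, P b -> B (z * b)].
have Qs : is_submodule B Q.
  split=> [b Pb|u v Qu Qv b Pb|d u Bd Qu b Pb].
  - by rewrite mul0r; apply: ring0.
  - by rewrite mulrDl; apply: ringD => //; [apply: Qu|apply: Qv].
  - by rewrite -mulrA; apply: ringM => //; apply: Qu.
have PQs : is_submodule B (mulm P Q) by apply: submod_mulm.
have PQB : mulm P Q `<=` B.
  by apply: (mulm_subset Bs) => b z Pb Qz; rewrite mulrC; apply: Qz.
have PPQ : P `<=` mulm P Q.
  move=> b Pb; rewrite -(mulr1 b); apply: mem_mulm => // d Pd.
  by rewrite mul1r; apply: PB.
have [_ _ Pmax] := Pm; case: (Pmax _ (conj PQs PQB) PPQ) => e; last by exists Q.
case: nBx; apply/(integralP _ Ar Af noeth); exists P.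
  apply: (frac_restrict Afl AB Bfrac); split=> //; first by exists a.
  exists 1; split; [exact: ring1|exact: oner_neq0|].
  by move=> b /PB; rewrite mul1r.
by move=> b Pb; rewrite mulrC -e; apply: mem_mulm.
Qed.

End NormalizationDedekind.

End Dedekind.
(** * Picard and Chow groups *)

Section Groups.
Context {K : fieldType}.
Implicit Types (A B I J L M N P X p q f : set K) (x y : K).

Lemma coset_add_eq (G : zmodType) (N : set G) (D E : G) : N 0 ->
  (forall u v, N u -> N v -> N (u - v)) ->
  coset_by +%R N D = coset_by +%R N E <-> N (D - E).
Proof.
move=> N0 NB; have NN u : N u -> N (- u) by move=> Nu; rewrite -sub0r; apply: NB.
have ND u v : N u -> N v -> N (u + v).
  by move=> Nu Nv; rewrite -(opprK v); apply: NB => //; apply: NN.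
split=> [e|h].
  have: coset_by +%R N D D by exists 0; rewrite ?addr0.
  by rewrite e => -[x Nx <-]; rewrite addrC addKr.
apply/seteqP; split=> _ [x Nx <-].
  by exists (D - E + x); [apply: ND|rewrite addrCA addrA subrK].
exists (x - (D - E)); first exact: NB.
by rewrite opprB addrCA (addrC D) subrK addrC.
Qed.

(** The representative picked by the induced map is irrelevant as soon as f is
    constant modulo N' on the coset. *)
Lemma induced_mapE (T T' : choiceType) (x0 x : T) (f : T -> T')
    (op : T -> T -> T) (op' : T' -> T' -> T') (N : set T) (N' : set T') :
  coset_by op N x !=set0 ->
  (forall y : T, coset_by op N x y -> coset_by op' N' (f y) = coset_by op' N' (f x)) ->
  induced_map x0 f op' N' (coset_by op N x) = coset_by op' N' (f x).
Proof. by move=> [y xy] h; apply/h; apply: xgetI xy. Qed.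

Lemma Pic_coset A M : is_subring A -> is_submodule A M ->
  coset_by mulm (principal_ideals A) M = [set principal M x | x in [set x | x != 0]].
Proof.
move=> Ar Ms; apply/seteqP; split=> [_ [_ [x x0 <-] <-]|_ [x x0 <-]].
  by exists x => //; rewrite mulm_scaler mulm_ringr.
by exists (principal A x); [exists x|rewrite mulm_scaler mulm_ringr].
Qed.

Lemma Pic_coset_eq A M N : is_subring A -> is_submodule A M -> is_submodule A N ->
  coset_by mulm (principal_ideals A) M = coset_by mulm (principal_ideals A) N <->
  exists2 x, x != 0 & M = principal N x.
Proof.
move=> Ar Ms Ns; rewrite !Pic_coset //; split=> [e|[x x0 ->]].
  have: [set principal M x | x in [set x | x != 0]] M.
    by exists 1; rewrite ?scale1 //= oner_neq0.
  by rewrite e => -[x x0 xE]; exists x.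
apply/seteqP; split=> _ [y y0 <-].
  by exists (y * x); rewrite ?scale_mul //=; apply: mulf_neq0.
exists (y / x); last by rewrite scale_mul divfK.
by rewrite /= mulf_neq0 ?invr_neq0.
Qed.

Lemma invertible_scale A M x : is_subring A -> has_fraction_field A -> x != 0 ->
  invertible_ideals A M -> invertible_ideals A (principal M x).
Proof.
move=> Ar Af x0 /(invertibleP _ Ar Af)[M' h]; apply/invertibleP => //.
have [Ms _ _] := h; rewrite -(mulm_principal x Ar Ms).
by eexists; apply: inverse_mul h; rewrite //; apply: inverse_scale.
Qed.

Section PicChow.
Variables (A : set K) (Afl : finlen_ring A).
Let Ar : is_subring A. Proof. exact: finlen_subring Afl. Qed.
Let Af : has_fraction_field A. Proof. by case: Afl. Qed.

Lemma principal_divisorsE D : principal_divisors A D <->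
  exists2 x, x != 0 & chi A (principal A x) = D.
Proof.
by split=> -[x x0 <-]; exists x => //; rewrite (div_eltE Afl).
Qed.

Lemma principal_divisors0 : principal_divisors A 0.
Proof.
apply/principal_divisorsE; exists 1; rewrite ?oner_neq0 // scale1.
exact: chi_ring.
Qed.

Lemma principal_divisorsB D E :
  principal_divisors A D -> principal_divisors A E -> principal_divisors A (D - E).
Proof.
move=> /principal_divisorsE[x x0 <-] /principal_divisorsE[y y0 <-].
apply/principal_divisorsE; exists (x / y); first by rewrite mulf_neq0 ?invr_neq0.
rewrite -scale_mul (chi_scale Afl x0); last exact: principal_frac (invr_neq0 y0).
by rewrite (chi_inv Afl (inverse_scale Ar y0)).
Qed.

Lemma Chow_eq D E : coset_by +%R (principal_divisors A) D =
  coset_by +%R (principal_divisors A) E <-> principal_divisors A (D - E).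
Proof.
by apply: coset_add_eq; [exact: principal_divisors0|exact: principal_divisorsB].
Qed.

Lemma div_barE M : invertible_ideals A M ->
  div_bar A (coset_by mulm (principal_ideals A) M) =
  coset_by +%R (principal_divisors A) (chi A M).
Proof.
move=> Mi; have [Mf _] := Mi; have Ms := frac_submod Mf.
rewrite /div_bar induced_mapE ?(div_idealE Afl) //.
  by rewrite Pic_coset //; exists M; exists 1; rewrite ?scale1 //= oner_neq0.
rewrite Pic_coset // => _ [x x0 <-]; have xi := invertible_scale Ar Af x0 Mi.
rewrite !(div_idealE Afl) //; apply/Chow_eq; rewrite (chi_scale Afl x0 Mf) addrK.
by apply/principal_divisorsE; exists x.
Qed.

Lemma div_bar_surj : set_surj (Pic A) (Chow A) (div_bar A) <->
  forall D, Div A D -> exists2 M, invertible_ideals A M & chi A M = D.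
Proof.
split=> [surj D hD|gen _ [D hD <-]].
  have [|_ [M Mi <-]] := surj (coset_by +%R (principal_divisors A) D); first by exists D.
  rewrite div_barE // => /Chow_eq /principal_divisorsE[x x0 xE].
  have [Mf _] := Mi; exists (principal M x^-1).
    by apply: invertible_scale => //; rewrite invr_neq0.
  rewrite (chi_scale Afl _ Mf) ?invr_neq0 // (chi_inv Afl (inverse_scale Ar x0)) xE.
  by rewrite opprB subrK.
have [M Mi <-] := gen D hD; exists (coset_by mulm (principal_ideals A) M).
  by exists M.
exact: div_barE.
Qed.

(** As chi is multiplicative on invertible ideals, injectivity is a statement about
    the kernel. *)
Lemma div_bar_inj : set_inj (Pic A) (div_bar A) <->
  forall M, invertible_ideals A M -> principal_divisors A (chi A M) ->
    exists2 x, x != 0 & M = principal A x.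
Proof.
have As := submod_ring Ar.
have Ai : invertible_ideals A A.
  by apply/invertibleP => //; exists A; split=> //; rewrite mulm_ring.
split=> [inj M Mi pM|inj _ _ /set_mem[M Mi <-] /set_mem[N Ni <-]].
  have [Mf _] := Mi; apply/(Pic_coset_eq Ar (frac_submod Mf) As).
  apply: inj; [by apply/mem_set; exists M|by apply/mem_set; exists A|].
  by rewrite !div_barE //; apply/Chow_eq; rewrite chi_ring // subr0.
have [Mf _] := Mi; have [Nf _] := Ni; have Ms := frac_submod Mf; have Ns := frac_submod Nf.
rewrite !div_barE // => /Chow_eq pMN; apply/(Pic_coset_eq Ar Ms Ns).
have /(invertibleP _ Ar Af)[M' hM] := Mi; have /(invertibleP _ Ar Af)[N' hN] := Ni.
have N'f := inverse_frac Ar Af (inverse_sym hN).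
have [||x x0 xE] := inj (mulm M N').
- by apply/invertibleP => //; eexists; apply: inverse_mul hM (inverse_sym hN).
- by rewrite (chi_mul Afl hM N'f) (chi_inv Afl hN).
exists x => //; have [_ _ e] := hN.
by rewrite -(mulm_ringr Ar Ms) -e mulmCA xE mulm_scaler mulm_ringr.
Qed.

End PicChow.

(** The Chow group of a local ring is the cokernel of its order function. *)
Lemma local_Chow A p : finlen_ring A -> maximal_ideals A p ->
  let Ap := localize A p A in
  Chow Ap = [set Chow0 Ap] <-> exists2 x, x != 0 & ord A p x = 1.
Proof.
move=> Afl pm Ap; have Ar := finlen_subring Afl.
have Apfl := loc_finlen Afl pm; pose m := localize A p p.
have mm : maximal_ideals Ap m := loc_maximal Afl pm.
have mu q : maximal_ideals Ap q -> q = m := loc_maximal_uniq Afl pm (q := q).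
split=> [e|[x x0 ox]].
  have: Chow Ap (coset_by +%R (principal_divisors Ap) << m >>).
    exists << m >> => // q; rewrite coeffU mul1r; case: (m =P q) => [<- //|_].
    by rewrite mulr0n eqxx.
  rewrite e => /(Chow_eq Apfl); rewrite subr0 => /(principal_divisorsE Apfl)[x x0 xE].
  exists x => //; rewrite -(ord_loc Afl pm x0) (ordE Apfl mm x0) xE.
  by rewrite coeffU mul1r eqxx.
have pd : Div Ap `<=` principal_divisors Ap.
  apply: Div_subgroup.
  - exact: principal_divisors0.
  - exact: principal_divisorsB.
  move=> _ /mu ->; apply/(principal_divisorsE Apfl); exists x => //.
  have hD := chi_Div Apfl (principal_frac Apfl x0).
  apply/eqP/freeg_eqP => q; rewrite coeffU mul1r; case: eqP => [<-|mq].
    by rewrite -(ordE Apfl mm x0) (ord_loc Afl pm x0).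
  have [-> //|/hD /mu qm] := eqVneq (coeff q (chi Ap (principal Ap x))) 0.
  by case: mq.
apply/seteqP; split=> [_ [D hD <-]|_ ->].
  by apply/(Chow_eq Apfl); rewrite subr0; apply: pd.
by exists 0 => // q; rewrite coeff0 eqxx.
Qed.

(** At a maximal ideal p, div takes on invertible ideals exactly the values that
    ord takes on elements: a local generator gives one inclusion, and
    [chi_primary] the other. *)
Lemma chi_surj_local A : finlen_ring A ->
  (forall D, Div A D -> exists2 M, invertible_ideals A M & chi A M = D) <->
  forall p, maximal_ideals A p -> exists2 x, x != 0 & ord A p x = 1.
Proof.
move=> Afl; have [Ar Af _] := Afl; split=> [surj p pm|loc].
  have [|M /(invertibleP _ Ar Af)[M' h] chiM] := surj << p >>.
    by move=> q; rewrite coeffU mul1r; case: (p =P q) => [<- //|_]; rewrite mulr0n eqxx.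
  have [x x0 xE] := invertible_loc Afl pm h; exists x => //.
  have Mf := inverse_frac Ar Af h; have xf := principal_frac Afl x0.
  rewrite (ordE Afl pm x0) -(coeff_chi_loc Afl pm Mf xf) ?loc_scale //.
  by rewrite chiM coeffU mul1r eqxx.
apply: (chi_surj Afl) => p pm; have [x x0] := loc p pm.
rewrite (ordE Afl pm x0); have [a [b [Aa Ab b0 xE]]] := Af x.
have a0 : a != 0 by apply: contraNneq x0 => a0; rewrite xE a0 mul0r.
have [M Mi Me] := chi_primary Afl pm Aa a0; have [N Ni Ne] := chi_primary Afl pm Ab b0.
have /(invertibleP _ Ar Af)[M' hM] := Mi; have /(invertibleP _ Ar Af)[N' hN] := Ni.
have hN' := inverse_sym hN.
rewrite xE -scale_mul (chi_scale Afl a0); last exact: principal_frac (invr_neq0 b0).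
rewrite (chi_inv Afl (inverse_scale Ar b0)) coeffB => ox.
exists (mulm M N'); first by apply/invertibleP => //; eexists; apply: inverse_mul hM hN'.
rewrite (chi_mul Afl hM (inverse_frac Ar Af hN')) (chi_inv Afl hN) Me Ne.
by rewrite freegUB ox.
Qed.

Section Normalization.
Variable O : set K.
Hypotheses (Or : is_subring O) (Of : has_fraction_field O).
Hypotheses (noeth : is_noetherian O) (dim1 : has_krull_dim O 1).
Hypothesis fg : finitely_generated O (normalization O).
Let B := normalization O.
Let Ofl := noetherian_dim1_finlen Or Of noeth dim1.
Let Br : is_subring B := normalization_ring Or Of noeth.
Let OB : O `<=` B := normalization_sub Or Of noeth.
Let Bfrac : is_fractional_ideal O B := normalization_frac Or Of noeth fg.
Let Bfl : finlen_ring B := extension_finlen Ofl Br OB Bfrac.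
Let Bf : has_fraction_field B. Proof. by case: Bfl. Qed.
Let Binv P : maximal_ideals B P -> exists Q, inverse_of B P Q :=
  normalization_primes_inv Or Of noeth dim1 fg (P := P).
Let Bs := submod_ring Br.
Let rs M : is_submodule B M -> is_submodule O M := submod_restrict OB (M := M).

Lemma chi_extend M M' : inverse_of O M M' ->
  chi O M = push_forward O B (chi B (mulm M B)).
Proof. by apply: push_chi => // P; apply: (maximal_frac Bfl Binv). Qed.

Lemma mulm_extend x : mulm (principal O x) B = principal B x.
Proof. by rewrite (mulm_principal _ Or (rs Bs)). Qed.

Lemma push_principal x : x != 0 ->
  push_forward O B (chi B (principal B x)) = chi O (principal O x).
Proof. by move=> x0; rewrite (chi_extend (inverse_scale Or x0)) mulm_extend. Qed.

Lemma Pic_extendE M : invertible_ideals O M ->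
  Pic_extend B (coset_by mulm (principal_ideals O) M) =
  coset_by mulm (principal_ideals B) (mulm M B).
Proof.
move=> [Mf _]; have Ms := frac_submod Mf; rewrite /Pic_extend induced_mapE //.
  by rewrite Pic_coset //; exists M; exists 1; rewrite ?scale1 //= oner_neq0.
rewrite Pic_coset // => _ [x x0 <-].
apply/(Pic_coset_eq Br (submod_mulmr _ Bs) (submod_mulmr _ Bs)).
by exists x => //; rewrite mulm_scalel.
Qed.

Lemma push_forward_barE D :
  push_forward_bar O B (coset_by +%R (principal_divisors B) D) =
  coset_by +%R (principal_divisors O) (push_forward O B D).
Proof.
rewrite /push_forward_bar induced_mapE //.
  by exists D; exists 0; rewrite ?addr0 //; apply: principal_divisors0.
move=> _ [_ /(principal_divisorsE Bfl)[x x0 <-] <-]; apply/(Chow_eq Ofl).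
rewrite push_forwardD addrC addKr push_principal //.
by apply/(principal_divisorsE Ofl); exists x.
Qed.

Lemma invertible_extend M : invertible_ideals O M -> invertible_ideals B (mulm M B).
Proof.
move=> /(invertibleP _ Or Of)[M' h]; apply/(invertibleP _ Br Bf); eexists.
exact: inverse_extend Ofl Br OB _ _ h.
Qed.

(** The conductor of O in B, a nonzero ideal of both, is the common ideal along
    which invertible ideals of B descend to O. *)
Lemma invertible_descend J : invertible_ideals B J ->
  exists2 M, invertible_ideals O M & mulm M B = J.
Proof.
move=> /(invertibleP _ Br Bf)[J' h].
have [_ _ [d [Od d0 dB]]] := Bfrac.
(* f is the conductor, nonzero since it contains d *)
pose f := [set a | forall b, B b -> O (a * b)].
have fO : f `<=` O by move=> a fa; rewrite -(mulr1 a); apply: fa; apply: ring1.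
have fi : is_ideal B f.
  split; last by move=> a /fO /OB.
  split=> [b _|a c fa fc b Bb|a c Ba fc b Bb].
  - by rewrite mul0r; apply: ring0.
  - by rewrite mulrDl; apply: ringD => //; [apply: fa|apply: fc].
  - by rewrite mulrAC mulrC; apply: fc; apply: ringM.
have [|y [z [Jy Jz fyz]]] := comaximal_generators Bfl h fi; first by exists d.
have [M [N [hM MJ]]] := inverse_descend Or Br OB fi fO h Jy Jz fyz.
by exists M => //; apply/(invertibleP _ Or Of); exists N.
Qed.

Lemma dedekind_principal J : invertible_ideals B J ->
  principal_divisors B (chi B J) -> exists2 x, x != 0 & J = principal B x.
Proof.
move=> /(invertibleP _ Br Bf)[J' h] /(principal_divisorsE Bfl)[x x0 e].
exists x => //; have hx := inverse_sym (inverse_scale Br x0).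
have Jf := inverse_frac Br Bf h.
rewrite -(scaleVK J x0); congr principal.
have h' := inverse_mul Br hx h.
rewrite -(mulm_principal _ Br (frac_submod Jf)).
apply: (chi_eq0 Bfl Binv h').
by rewrite (chi_mul Bfl hx Jf) (chi_inv Bfl (inverse_scale Br x0)) e addNr.
Qed.

Lemma push_principal_divisors D :
  principal_divisors B D -> principal_divisors O (push_forward O B D).
Proof.
move=> /(principal_divisorsE Bfl)[x x0 <-]; rewrite push_principal //.
by apply/(principal_divisorsE Ofl); exists x.
Qed.

Lemma ker_trivialP :
  ker_push_forward_bar O B = [set Chow0 B] <->
  forall D, Div B D -> principal_divisors O (push_forward O B D) ->
    principal_divisors B D.
Proof.
split=> [e D hD pD|h].
  have: ker_push_forward_bar O B (coset_by +%R (principal_divisors B) D).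
    split; first by exists D.
    by rewrite push_forward_barE; apply/(Chow_eq Ofl); rewrite subr0.
  by rewrite e => /(Chow_eq Bfl); rewrite subr0.
apply/seteqP; split=> [_ [[D hD <-]]|_ ->].
  rewrite push_forward_barE => /(Chow_eq Ofl); rewrite subr0 => pD.
  by apply/(Chow_eq Bfl); rewrite subr0; apply: h.
split; first by exists 0 => // q; rewrite coeff0 eqxx.
by rewrite push_forward_barE push_forward0.
Qed.

Lemma Pic_extend_bijP :
  set_bij (Pic O) (Pic B) (Pic_extend B) <->
  forall M, invertible_ideals O M -> (exists2 x, x != 0 & mulm M B = principal B x) ->
    exists2 x, x != 0 & M = principal O x.
Proof.
have Os := submod_ring Or.
have Oi : invertible_ideals O O.
  by apply/invertibleP => //; exists O; split=> //; rewrite mulm_ring.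
split=> [[_ inj _] M Mi [x x0 xE]|h].
  have [Mf _] := Mi; apply/(Pic_coset_eq Or (frac_submod Mf) Os).
  apply: inj; [by apply/mem_set; exists M|by apply/mem_set; exists O|].
  rewrite !Pic_extendE // (mulm_ring Or (rs Bs)) xE.
  by apply/(Pic_coset_eq Br (submod_scale x Bs) Bs); exists x.
split.
- by move=> _ [M Mi <-]; rewrite /= Pic_extendE //; eexists; [apply: invertible_extend Mi|].
- move=> _ _ /set_mem[M Mi <-] /set_mem[N Ni <-].
  have [Mf _] := Mi; have [Nf _] := Ni; have Ms := frac_submod Mf; have Ns := frac_submod Nf.
  have MBs := submod_mulmr M Bs; have NBs := submod_mulmr N Bs.
  rewrite !Pic_extendE // => /(Pic_coset_eq Br MBs NBs)[x x0 MN].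
  apply/(Pic_coset_eq Or Ms Ns).
  have /(invertibleP _ Or Of)[N' hN] := Ni; have /(invertibleP _ Or Of)[M' hM] := Mi.
  have [_ N's eN] := hN.
  have [||u u0 uE] := h (mulm M N').
  + by apply/invertibleP => //; eexists; apply: inverse_mul hM (inverse_sym hN).
  + exists x => //; rewrite -mulmA (mulmC N') mulmA MN mulm_scalel -mulmA (mulmC B).
    by rewrite mulmA eN mulm_ring //; apply: rs.
  exists u => //.
  by rewrite -(mulm_ringr Or Ms) -eN mulmCA uE mulm_scaler mulm_ringr.
- move=> _ [J Ji <-]; have [M Mi <-] := invertible_descend Ji.
  by exists (coset_by mulm (principal_ideals O) M); [exists M|apply: Pic_extendE].
Qed.

(** The map of Pic O to Chow O factors as Pic O -> Pic B = Chow B -> Chow O, by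
    [chi_extend]; the first map is onto by [invertible_descend], so the composite
    is injective exactly when both the first and the last map are. *)
Lemma div_bar_injP :
  set_inj (Pic O) (div_bar O) <->
  set_bij (Pic O) (Pic B) (Pic_extend B) /\ ker_push_forward_bar O B = [set Chow0 B].
Proof.
have chiE M : invertible_ideals O M -> chi O M = push_forward O B (chi B (mulm M B)).
  by move=> /(invertibleP _ Or Of)[M' h]; apply: chi_extend h.
rewrite (div_bar_inj Ofl) Pic_extend_bijP ker_trivialP.
split=> [inj|[injE ker] M Mi pM]; last first.
  have MBi := invertible_extend Mi; have [MBf _] := MBi.
  apply: injE => //; apply: dedekind_principal => //.
  by apply: ker; rewrite -?chiE //; apply: chi_Div.
split=> [M Mi [x x0 xE]|D hD pD].
  apply: inj => //; rewrite chiE // xE; apply: push_principal_divisors.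
  by apply/(principal_divisorsE Bfl); exists x.
have [J Ji JD] := dedekind_chi_surj Bfl Binv hD.
have [M Mi MJ] := invertible_descend Ji.
have [|x x0 xE] := inj M Mi; first by rewrite chiE // MJ JD.
apply/(principal_divisorsE Bfl); exists x => //.
by rewrite -JD -MJ xE mulm_extend.
Qed.

End Normalization.
End Groups.

Theorem proposition2p10 (K : fieldType) (O : set K)
    (O_ring : is_subring O)
    (O_frac : has_fraction_field O)
    (O_noetherian : is_noetherian O)
    (O_dim1 : has_krull_dim O 1)
    (normalization_fg : finitely_generated O (normalization O)) :
  (set_surj (Pic O) (Chow O) (div_bar O) <->
   forall p, maximal_ideals O p ->
     Chow (localize O p O) = [set Chow0 (localize O p O)])
  /\
  (set_inj (Pic O) (div_bar O) <->
   set_bij (Pic O) (Pic (normalization O)) (Pic_extend (normalization O))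
   /\ ker_push_forward_bar O (normalization O) = [set Chow0 (normalization O)]).
Proof.
have Ofl := noetherian_dim1_finlen O_ring O_frac O_noetherian O_dim1.
split; last exact: div_bar_injP.
rewrite (div_bar_surj Ofl) (chi_surj_local Ofl).
by split=> h p pm; apply/(local_Chow Ofl pm); apply: h.
Qed.
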